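(* Let $0<q<1$ and $\nu>-1$. For every integer $n\ge1$, the $q$-Rayleigh function $\sigma_{2n}^{(2)}(\nu;q^2)$ of even order associated with the zeros of the second Jackson $q$-Bessel function is given by $$\sigma_{2n}^{(2)}(\nu;q^2)=-\sum_{k=1}^{\infty}\frac{J_{\nu+1}^{(2)}(j_{k,\nu}(q^2);q^2)}{{J_{\nu}^{(2)}}'(j_{k,\nu}(q^2);q^2)}\,\bigl(j_{k,\nu}(q^2)\bigr)^{-2n}.$$
   Context: Let $(a;p)_n=\prod_{j=0}^{n-1}(1-ap^j)$ and $(a;p)_\infty=\prod_{j\ge0}(1-ap^j)$. The second Jackson $q$-Bessel function with base $p\in(0,1)$ is $$J_\nu^{(2)}(z;p)=\frac{(p^{\nu+1};p)_\infty}{(p;p)_\infty}\sum_{n=0}^\infty\frac{(-1)^np^{n(n+\nu)}}{(p;p)_n(p^{\nu+1};p)_n}\Bigl(\frac z2\Bigr)^{2n+\nu};$$ here it is used with $p=q^2$. For $\nu>-1$ its zeros (apart from $0$) are real and simple; $j_{k,\nu}(q^2)$, $k=1,2,\dots$, denote the positive zeros of $J_\nu^{(2)}(\cdot;q^2)$ in increasing order, and the prime denotes the derivative with respect to the first argument. The $q$-Rayleigh functions $\sigma^{(2)}_{2n}(\nu;q^2)$ are defined by the expansion, valid for small $|z|$, $$\frac{J_{\nu+1}^{(2)}(z;q^2)}{J_{\nu}^{(2)}(z;q^2)}=2\sum_{n=1}^{\infty}\sigma^{(2)}_{2n}(\nu;q^2)\,z^{2n-1}.$$ *)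

(* Defs.v *)
From Stdlib Require Import Reals.
From Coquelicot Require Import Coquelicot.

Open Scope R_scope.

Fixpoint qpoch (a p : R) (n : nat) : R :=
  match n with
  | O => 1
  | S m => qpoch a p m * (1 - a * p ^ m)
  end.

Definition qpoch_inf (a p : R) : R := real (Lim_seq (qpoch a p)).

(* The second Jackson q-Bessel function on the positive half-line.  Real powers
   are [Rpower], which is the usual power only for a positive base: the values
   are meaningful for [0 < z] and [0 < p < 1]. *)
Definition jackson2 (nu z p : R) : R :=
  qpoch_inf (Rpower p (nu + 1)) p / qpoch_inf p p *
  Series (fun n : nat =>
    (-1) ^ n * Rpower p (INR n * (INR n + nu)) /
      (qpoch p p n * qpoch (Rpower p (nu + 1)) p n) *
    Rpower (z / 2) (2 * INR n + nu)).

(* [j 1, j 2, ...] lists the positive zeros of [f] in increasing order; [j 0] is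
   unconstrained. *)
Definition positive_zeros (f : R -> R) (j : nat -> R) : Prop :=
  (forall k : nat, (1 <= k)%nat -> j k < j (S k)) /\
  (forall z : R, 0 < z /\ f z = 0 <-> exists k : nat, (1 <= k)%nat /\ j k = z).

(* [sigma n] is the q-Rayleigh function of order [2 * n] (in base [p]) for
   [1 <= n]; [sigma 0] is unconstrained.  The quotient of the two Bessel
   functions is an odd analytic function near 0, so its expansion is already
   determined by its values at small positive [z], where [jackson2] is
   meaningful. *)
Definition q_rayleigh (nu p : R) (sigma : nat -> R) : Prop :=
  exists r : R, 0 < r /\
    forall z : R, 0 < z < r ->
      let a := fun m : nat => sigma (S m) * z ^ (2 * S m - 1) in
      ex_series a /\
      jackson2 (nu + 1) z p / jackson2 nu z p = 2 * Series a.

(* Main.v *)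
Require Import Defs.
From Stdlib Require Import Reals Lra Lia Psatz Arith.
From Coquelicot Require Import Coquelicot.

Open Scope R_scope.

(* Up to a constant and the power [z^nu], the functions [J_(nu+i)] are
   [f_i = qb (p^(nu+1+i))] evaluated at [(z/2)^2], and they satisfy
   [f_i = f_(i+1) - x beta_i f_(i+2)] with [beta_i > 0] decaying geometrically.
   After rescaling, [u(z)_i = z^i sqrt(beta_0 ... beta_(i-1)) f_(i+1)(z^2)] solves
   [(1 - z A) u(z) = f_0(z^2) e_0] in l^2, where [A] is the symmetric Jacobi operator
   with zero diagonal and off-diagonal entries [sqrt beta_i]. Hence [±z] is a zero of
   [f_0(z^2)] exactly when [u(±z)] is an eigenvector of eigenvalue [±1/z], and
   [f_1/f_0 (z^2) = <e_0, (1 - z A)^-1 e_0>] has the Taylor coefficients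
   [|A^m e_0|^2], which are the q-Rayleigh functions up to a factor. The theorem
   is Parseval's identity for [A^m e_0] in these eigenvectors, because
   [<u(z), u(t)>] (Christoffel-Darboux) expresses [|u(z)|^2] at a zero through the
   derivative of [f_0]. Completeness of the eigenvectors is obtained without spectral
   theory: the part [w] of [e_0] orthogonal to the first [K] of them satisfies
   [|A^(m+1) w|^2 <= |A^m w|^2 / z_K^2], and [e_0] lies in the closure of the range
   of [A], which handles [m = 0]. *)

(** * Square-summable sequences *)

Definition l2 (v : nat -> R) : Prop := ex_series (fun i => v i ^ 2).
Definition dot (v w : nat -> R) : R := Series (fun i => v i * w i).
Definition vplus (v w : nat -> R) : nat -> R := fun i => v i + w i.
Definition vscal (c : R) (v : nat -> R) : nat -> R := fun i => c * v i.
Definition basis0 (i : nat) : R := match i with O => 1 | S _ => 0 end.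

Lemma ex_series_dom (a b : nat -> R) :
  (forall n, Rabs (a n) <= b n) -> ex_series b -> ex_series a.
Proof. intros H Hb. exact (ex_series_le a b H Hb). Qed.

Lemma ex_series_Rplus (a b : nat -> R) :
  ex_series a -> ex_series b -> ex_series (fun n => a n + b n).
Proof. exact (ex_series_plus a b). Qed.

Lemma ex_series_Rscal (c : R) (a : nat -> R) :
  ex_series a -> ex_series (fun n => c * a n).
Proof. exact (ex_series_scal c a). Qed.

Lemma sum_S_R (a : nat -> R) n : sum_n a (S n) = sum_n a n + a (S n) :> R.
Proof. exact (sum_Sn a n). Qed.

Lemma Series_finite (a : nat -> R) (n : nat) :
  (forall i, (n <= i)%nat -> a i = 0) -> is_series a (sum_n a n).
Proof.
intros H. apply is_series_Reals. intros e He. exists n. intros m Hm.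
replace (sum_f_R0 a m) with (sum_n a n).
- unfold Rdist. rewrite Rminus_diag, Rabs_R0. exact He.
- rewrite <- sum_n_Reals. induction Hm as [|m Hm IH]; [easy|].
  rewrite sum_S_R, <- IH, (H (S m)) by lia. symmetry. apply Rplus_0_r.
Qed.

Lemma l2_mult v w : l2 v -> l2 w -> ex_series (fun i => v i * w i).
Proof.
intros Hv Hw.
apply ex_series_dom with (fun i => v i ^ 2 + w i ^ 2).
- intros i. apply Rabs_le. split; nra.
- now apply ex_series_Rplus.
Qed.

Lemma l2_plus v w : l2 v -> l2 w -> l2 (vplus v w).
Proof.
intros Hv Hw. unfold l2, vplus.
apply ex_series_dom with (fun i => 2 * (v i ^ 2 + w i ^ 2)).
- intros i. rewrite Rabs_pos_eq by apply pow2_ge_0.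
  generalize (pow2_ge_0 (v i - w i)). nra.
- now apply ex_series_Rscal, ex_series_Rplus.
Qed.

Lemma l2_scal c v : l2 v -> l2 (vscal c v).
Proof.
intros Hv. unfold l2, vscal.
apply ex_series_ext with (fun i => c ^ 2 * v i ^ 2); [intros i; simpl; ring|].
now apply ex_series_Rscal.
Qed.

Lemma l2_basis0 : l2 basis0.
Proof.
eexists. apply (Series_finite _ 1). intros [|i] Hi; [lia|]. simpl; ring.
Qed.

Lemma dot_comm v w : dot v w = dot w v.
Proof. apply Series_ext. intros; ring. Qed.

Lemma dot_ext v v' w w' :
  (forall i, v i = v' i) -> (forall i, w i = w' i) -> dot v w = dot v' w'.
Proof. intros H H'. apply Series_ext. intros i. now rewrite H, H'. Qed.

Lemma dot_plus_l v v' w : l2 v -> l2 v' -> l2 w ->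
  dot (vplus v v') w = dot v w + dot v' w.
Proof.
intros. unfold dot, vplus. rewrite <- Series_plus; try now apply l2_mult.
apply Series_ext; intros; ring.
Qed.

Lemma dot_scal_l c v w : dot (vscal c v) w = c * dot v w.
Proof.
unfold dot, vscal. rewrite <- Series_scal_l.
apply Series_ext; intros; ring.
Qed.

Lemma dot_plus_r v w w' : l2 v -> l2 w -> l2 w' ->
  dot v (vplus w w') = dot v w + dot v w'.
Proof. intros. rewrite !(dot_comm v). now apply dot_plus_l. Qed.

Lemma dot_scal_r c v w : dot v (vscal c w) = c * dot v w.
Proof. rewrite !(dot_comm v). apply dot_scal_l. Qed.

Lemma dot_basis0_l v : dot basis0 v = v O.
Proof.
apply is_series_unique.
replace (v O) with (sum_n (fun i => basis0 i * v i) 1 : R).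
- apply Series_finite. intros [|i] Hi; [lia|]. simpl; ring.
- rewrite sum_S_R, sum_O. simpl. ring.
Qed.

Lemma dot_basis0_r v : dot v basis0 = v O.
Proof. rewrite dot_comm. apply dot_basis0_l. Qed.

Lemma Series_nonneg (a : nat -> R) : (forall i, 0 <= a i) -> ex_series a -> 0 <= Series a.
Proof.
intros H Ha. replace 0 with (Series (fun _ => 0)).
2: { apply is_series_unique. generalize (Series_finite (fun _ => 0) 0 (fun _ _ => eq_refl)). now rewrite sum_O. }
apply Series_le; [|easy]. intros i; split; [lra|apply H].
Qed.

Lemma sum_n_le_Series (a : nat -> R) n :
  (forall i, 0 <= a i) -> ex_series a -> sum_n a n <= Series a.
Proof.
intros H Ha.
rewrite (Series_incr_n a (S n)); [|lia|easy]. simpl pred.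
rewrite <- sum_n_Reals.
assert (0 <= Series (fun k => a (S n + k)%nat)).
{ apply Series_nonneg; [intros; apply H|]. now apply (proj1 (ex_series_incr_n a (S n))). }
lra.
Qed.

Lemma dot_self_nonneg v : l2 v -> 0 <= dot v v.
Proof.
intros Hv. apply Series_nonneg; [intros; nra|]. now apply l2_mult.
Qed.

Lemma coord_sq_le v i : l2 v -> v i ^ 2 <= dot v v.
Proof.
intros Hv.
apply Rle_trans with (sum_n (fun i => v i * v i) i).
- destruct i as [|i]; [rewrite sum_O; nra|].
  rewrite sum_S_R.
  assert (0 <= sum_n (fun i => v i * v i) i); [|nra].
  rewrite sum_n_Reals. apply cond_pos_sum. intros; nra.
- apply sum_n_le_Series; [intros; nra|]. now apply l2_mult.
Qed.

Lemma dot_self_pos v i : l2 v -> v i <> 0 -> 0 < dot v v.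
Proof.
intros Hv Hi. apply Rlt_le_trans with (v i ^ 2); [|now apply coord_sq_le].
nra.
Qed.

Lemma dot_self_lincomb a b v w : l2 v -> l2 w ->
  dot (vplus (vscal a v) (vscal b w)) (vplus (vscal a v) (vscal b w)) =
  a ^ 2 * dot v v + 2 * a * b * dot v w + b ^ 2 * dot w w.
Proof.
intros Hv Hw.
assert (l2 (vscal a v)) by now apply l2_scal.
assert (l2 (vscal b w)) by now apply l2_scal.
rewrite dot_plus_l, !dot_plus_r, !dot_scal_l, !dot_scal_r, (dot_comm w v);
  auto using l2_plus.
ring.
Qed.

(** The quadratic form in [P] is nonnegative; at [a = dot w w], [b = - dot v w] it equals [dot w w]
    times the difference of the two sides. *)
Lemma Cauchy_Schwarz v w : l2 v -> l2 w -> dot v w ^ 2 <= dot v v * dot w w.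
Proof.
intros Hv Hw.
assert (P : forall a b, 0 <= a ^ 2 * dot v v + 2 * a * b * dot v w + b ^ 2 * dot w w).
{ intros a b. rewrite <- dot_self_lincomb by easy.
  apply dot_self_nonneg. auto using l2_plus, l2_scal. }
generalize (dot_self_nonneg _ Hv) (dot_self_nonneg _ Hw); intros Nv Nw.
destruct (Req_dec (dot w w) 0) as [E|E].
- destruct (Req_dec (dot v w) 0) as [E'|E']; [rewrite E', E; lra|].
  (* With [dot w w = 0] the form is affine in [b]; this choice of [b] gives it the value
     [- dot v v - 2], which is negative. *)
  assert (H := P 1 (- (dot v v + 1) / dot v w)). rewrite E in H.
  replace (2 * 1 * (- (dot v v + 1) / dot v w) * dot v w)
    with (- 2 * (dot v v + 1)) in H by now field.
  lra.
- generalize (P (dot w w) (- dot v w)). intros H.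
  assert (0 <= dot w w * (dot v v * dot w w - dot v w ^ 2)) by nra.
  assert (0 < dot w w) by lra.
  apply Rmult_le_reg_l with (dot w w); [easy|]. nra.
Qed.

(** Parallelogram law with the squared norm of the difference dropped. *)
Lemma dot_self_plus_le v w : l2 v -> l2 w ->
  dot (vplus v w) (vplus v w) <= 2 * dot v v + 2 * dot w w.
Proof.
intros Hv Hw.
assert (H := dot_self_nonneg _ (l2_plus _ _ Hv (l2_scal (-1) _ Hw))).
rewrite dot_plus_l, !dot_plus_r, !dot_scal_l, !dot_scal_r, (dot_comm w v) in H;
  auto using l2_plus, l2_scal.
rewrite dot_plus_l, !dot_plus_r, (dot_comm w v); auto using l2_plus.
lra.
Qed.

(** * Jacobi operators *)

Definition shiftr (v : nat -> R) (i : nat) : R :=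
  match i with O => 0 | S k => v k end.

Lemma l2_shiftr v : l2 v -> l2 (shiftr v).
Proof.
intros Hv. apply (proj2 (ex_series_incr_1 (fun i => shiftr v i ^ 2))). exact Hv.
Qed.

Lemma dot_shiftr v w : l2 v -> l2 w ->
  dot (shiftr v) w = dot v (fun i => w (S i)).
Proof.
intros Hv Hw. unfold dot. rewrite Series_incr_1.
- simpl. ring.
- apply l2_mult; [now apply l2_shiftr|easy].
Qed.

Lemma l2_shiftl v : l2 v -> l2 (fun i => v (S i)).
Proof. intros Hv. exact (proj1 (ex_series_incr_1 (fun i => v i ^ 2)) Hv). Qed.

Lemma dot_shiftl_le v : l2 v -> dot (fun i => v (S i)) (fun i => v (S i)) <= dot v v.
Proof.
intros Hv. unfold dot. rewrite (Series_incr_1 (fun i => v i * v i)).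
- nra.
- now apply l2_mult.
Qed.

Lemma dot_self_le v w : (forall i, Rabs (v i) <= Rabs (w i)) -> l2 w ->
  l2 v /\ dot v v <= dot w w.
Proof.
intros H Hw.
assert (H' : forall i, v i ^ 2 <= w i ^ 2) by (intros i; rewrite <- (pow2_abs (v i)), <- (pow2_abs (w i));
      apply pow_incr; split; [apply Rabs_pos|apply H]).
split.
- apply ex_series_dom with (fun i => w i ^ 2); [|easy].
  intros i. rewrite Rabs_pos_eq by apply pow2_ge_0. apply H'.
- apply Series_le; [|now apply l2_mult].
  intros i. specialize (H' i). nra.
Qed.

Section Jacobi.

Variable s : nat -> R.

Definition jac (v : nat -> R) (i : nat) : R :=
  s i * v (S i) + shiftr (fun k => s k * v k) i.

Lemma jac_plus v w i : jac (vplus v w) i = vplus (jac v) (jac w) i.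
Proof. unfold jac, vplus. destruct i; simpl; ring. Qed.

Lemma jac_scal c v i : jac (vscal c v) i = vscal c (jac v) i.
Proof. unfold jac, vscal. destruct i; simpl; ring. Qed.

Lemma jac_ext v w : (forall i, v i = w i) -> forall i, jac v i = jac w i.
Proof. intros H i. unfold jac. destruct i; simpl; now rewrite !H. Qed.

(** Neither shift increases the norm, and [dot_self_plus_le] contributes the factor 4. It serves
    twice: for [jac] itself, with [e] a bound for all of [s], and for the tail of [jac v], with [e]
    small. *)
Lemma neighbours_bound e y v : 0 <= e -> l2 v ->
  (forall i, Rabs (y i) <= e * (Rabs (v (S i)) + Rabs (shiftr v i))) ->
  l2 y /\ dot y y <= 4 * e ^ 2 * dot v v.
Proof.
intros He Hv H.
set (w := vplus (vscal e (fun i => Rabs (v (S i)))) (vscal e (fun i => Rabs (shiftr v i)))).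
destruct (dot_self_le (fun i => Rabs (v (S i))) (fun i => v (S i))) as [La Da];
  [intros; rewrite Rabs_Rabsolu; lra|now apply l2_shiftl|].
destruct (dot_self_le (fun i => Rabs (shiftr v i)) (shiftr v)) as [Lb Db];
  [intros; rewrite Rabs_Rabsolu; lra|now apply l2_shiftr|].
assert (Hw : l2 w) by (unfold w; auto using l2_plus, l2_scal).
destruct (dot_self_le y w) as [Ly Dy]; [|easy|].
{ intros i. unfold w, vplus, vscal. rewrite (Rabs_pos_eq (_ + _)).
  - specialize (H i). lra.
  - generalize (Rabs_pos (v (S i))) (Rabs_pos (shiftr v i)). nra. }
split; [easy|].
apply Rle_trans with (1 := Dy). unfold w.
apply Rle_trans with (1 := dot_self_plus_le _ _ (l2_scal _ _ La) (l2_scal _ _ Lb)).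
rewrite !dot_scal_l, !dot_scal_r.
assert (H1 := dot_shiftl_le v Hv).
assert (H2 : dot (shiftr v) (shiftr v) = dot v v).
{ rewrite dot_shiftr; [easy|easy|now apply l2_shiftr]. }
assert (0 <= e ^ 2) by nra.
nra.
Qed.

Hypothesis s_pos : forall i, 0 < s i.
Hypothesis s_lim : forall e, 0 < e -> exists n, forall i, (n <= i)%nat -> s i <= e.

Lemma s_bounded : exists M, 0 < M /\ forall i, s i <= M.
Proof.
destruct (s_lim 1 Rlt_0_1) as [n Hn].
assert (H : forall m, exists M, 0 < M /\ forall i, (i < m)%nat -> s i <= M).
{ induction m as [|m [M [HM IH]]].
  - exists 1. split; [lra|intros; lia].
  - exists (Rmax M (s m)). split; [apply Rlt_le_trans with (1 := HM), Rmax_l|].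
    intros i Hi. destruct (Nat.eq_dec i m) as [->|].
    + apply Rmax_r.
    + apply Rle_trans with M; [apply IH; lia|apply Rmax_l]. }
destruct (H n) as [M [HM HM']].
exists (Rmax M 1). split; [apply Rlt_le_trans with (1 := HM), Rmax_l|].
intros i. destruct (le_lt_dec n i) as [L|L].
- apply Rle_trans with 1; [now apply Hn|apply Rmax_r].
- apply Rle_trans with M; [now apply HM'|apply Rmax_l].
Qed.

Lemma jac_coord_le e n v i : (forall k, (n <= k)%nat -> s k <= e) -> (n < i)%nat ->
  Rabs (jac v i) <= e * (Rabs (v (S i)) + Rabs (shiftr v i)).
Proof.
intros He Hi. destruct i as [|i]; [lia|]. unfold jac; simpl.
apply Rle_trans with (1 := Rabs_triang _ _).
rewrite !Rabs_mult, (Rabs_pos_eq (s (S i))), (Rabs_pos_eq (s i)) by (generalize s_pos; intros P; apply Rlt_le, P).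
generalize (He (S i) ltac:(lia)) (He i ltac:(lia)) (Rabs_pos (v (S (S i)))) (Rabs_pos (v i)).
nra.
Qed.

Lemma jac_bounded : exists M, 0 < M /\
  forall v, l2 v -> l2 (jac v) /\ dot (jac v) (jac v) <= M * dot v v.
Proof.
destruct s_bounded as [M [HM H]]. exists (4 * M ^ 2). split; [nra|].
intros v Hv. apply neighbours_bound; [lra|easy|].
intros [|i]; [|apply jac_coord_le with O; [auto|lia]].
unfold jac; simpl. rewrite Rplus_0_r, Rabs_R0, Rplus_0_r, Rabs_mult.
rewrite (Rabs_pos_eq (s 0)) by (generalize (s_pos 0); lra).
apply Rmult_le_compat_r; [apply Rabs_pos|apply H].
Qed.

Lemma l2_jac v : l2 v -> l2 (jac v).
Proof. destruct jac_bounded as [M [_ H]]. intros Hv. now apply H. Qed.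

Lemma l2_smul v : l2 v -> l2 (fun i => s i * v i).
Proof.
intros Hv. destruct s_bounded as [M [HM H]].
destruct (dot_self_le (fun i => s i * v i) (vscal M v)); [|now apply l2_scal|easy].
intros i. unfold vscal. rewrite !Rabs_mult, (Rabs_pos_eq M), (Rabs_pos_eq (s i)) by (generalize (s_pos i); lra).
apply Rmult_le_compat_r; [apply Rabs_pos|apply H].
Qed.

(** The two shifts are adjoint, so both sides split into the same two products of a shifted and a
    weighted sequence. *)
Lemma jac_sym v w : l2 v -> l2 w -> dot (jac v) w = dot v (jac w).
Proof.
assert (E : forall v w, l2 v -> l2 w -> dot (jac v) w =
   dot (fun i => v (S i)) (fun i => s i * w i) + dot (fun i => s i * v i) (fun i => w (S i))).
{ intros a b Ha Hb. rewrite <- (dot_shiftr _ b); [|now apply l2_smul|easy].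
  unfold dot. rewrite <- Series_plus.
  - apply Series_ext. intros i. unfold jac. ring.
  - apply l2_mult; [now apply l2_shiftl|now apply l2_smul].
  - apply l2_mult; [now apply l2_shiftr, l2_smul|easy]. }
intros Hv Hw. rewrite (dot_comm v), !E by easy.
rewrite Rplus_comm. f_equal; apply dot_comm.
Qed.

(** Since [z * s n] is nonzero, row [n] of [y = v - z A v] gives [v (S n)] in terms of [v n],
    [v (n - 1)] and [y n]; induction then bounds each coordinate by [y] and [v O]. *)
Lemma forward_bound z : z <> 0 -> forall n, exists C, 0 <= C /\
  forall v, l2 v -> forall i, (i <= n)%nat ->
  let y := vplus v (vscal (- z) (jac v)) in
  v i ^ 2 <= C * (dot y y + v O ^ 2).
Proof.
intros Hz. induction n as [|n [C [HC IH]]].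
- exists 1. split; [lra|]. intros v Hv i Hi y.
  replace i with O by lia.
  assert (0 <= dot y y); [|lra].
  apply dot_self_nonneg. unfold y. auto using l2_plus, l2_scal, l2_jac.
- assert (P : 0 < z ^ 2 * s n ^ 2) by (generalize (s_pos n); intros; apply Rmult_lt_0_compat; nra).
  (* Row 0 has no lower neighbour: there [m] is a dummy value, and the number [a] found below is
     0. *)
  set (m := s (pred n)).
  (* The factor 3 comes from the square of a sum of three terms; the denominator is the square of
     the coefficient of [v (S n)] in row [n]. *)
  set (D := 3 * (C + 1 + z ^ 2 * m ^ 2 * C) / (z ^ 2 * s n ^ 2)).
  assert (HD : 0 <= D).
  { apply Rmult_le_pos; [|now apply Rlt_le, Rinv_0_lt_compat].
    assert (0 <= z ^ 2 * m ^ 2 * C) by (apply Rmult_le_pos; nra). lra. }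
  exists (C + D). split; [lra|].
  intros v Hv i Hi y.
  assert (Ly : l2 y) by (unfold y; auto using l2_plus, l2_scal, l2_jac).
  assert (Q : 0 <= dot y y + v O ^ 2) by (generalize (dot_self_nonneg y Ly); nra).
  destruct (Nat.eq_dec i (S n)) as [->|Ne].
  2: { apply Rle_trans with (1 := IH v Hv i ltac:(lia)). fold y. nra. }
  assert (R : exists a, a ^ 2 <= C * (dot y y + v O ^ 2) /\
     z * s n * v (S n) = v n - y n - z * (m * a)).
  { unfold m. destruct n as [|n].
    - exists 0. split; [|unfold y, vplus, vscal, jac; simpl; ring].
      replace (0 ^ 2) with 0 by ring. now apply Rmult_le_pos.
    - exists (v n). split; [apply (IH v Hv n); lia|].
      unfold y, vplus, vscal, jac; simpl; ring. }
  destruct R as [a [Ha Ea]].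
  assert (Hn := IH v Hv n ltac:(lia)). simpl in Hn. fold y in Hn.
  assert (Hy := coord_sq_le y n Ly).
  set (q := dot y y + v O ^ 2) in *.
  assert (q1 : y n ^ 2 <= q) by (unfold q; nra).
  assert (T : z ^ 2 * s n ^ 2 * v (S n) ^ 2 <= 3 * (C + 1 + z ^ 2 * m ^ 2 * C) * q).
  { replace (z ^ 2 * s n ^ 2 * v (S n) ^ 2) with ((z * s n * v (S n)) ^ 2) by ring.
    rewrite Ea.
    assert (T3 : forall a b c, (a - b - c) ^ 2 <= 3 * (a ^ 2 + b ^ 2 + c ^ 2)).
    { intros x b c. generalize (pow2_ge_0 (x + b)) (pow2_ge_0 (x + c)) (pow2_ge_0 (b - c)). nra. }
    apply Rle_trans with (1 := T3 _ _ _).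
    assert (z ^ 2 * m ^ 2 * a ^ 2 <= z ^ 2 * m ^ 2 * (C * q)).
    { apply Rmult_le_compat_l; [nra|easy]. }
    replace ((z * (m * a)) ^ 2) with (z ^ 2 * m ^ 2 * a ^ 2) by ring.
    replace (3 * (C + 1 + z ^ 2 * m ^ 2 * C) * q)
      with (3 * (C * q + q + z ^ 2 * m ^ 2 * (C * q))) by ring.
    change (v n ^ 2 <= C * q) in Hn. lra. }
  apply Rle_trans with (D * q); [|nra].
  unfold D. apply Rmult_le_reg_l with (1 := P).
  apply Rle_trans with (1 := T). right. field. split; [apply Rgt_not_eq, s_pos|easy].
Qed.

Lemma Series_indicator (c : R) n :
  is_series (fun i => if (i <=? n)%nat then c else 0) (INR (S n) * c).
Proof.
replace (INR (S n) * c) with (sum_n (fun i => if (i <=? n)%nat then c else 0) (S n) : R).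
- apply Series_finite. intros i Hi. now rewrite (proj2 (Nat.leb_gt i n)).
- rewrite sum_S_R. rewrite (proj2 (Nat.leb_gt (S n) n)), Rplus_0_r by lia.
  rewrite (sum_n_ext_loc _ (fun _ => c)).
  + rewrite sum_n_const. simpl; easy.
  + intros k Hk. now rewrite (proj2 (Nat.leb_le k n)).
Qed.

(* The forward recurrence controls finitely many coordinates, and the smallness
   of [s] at infinity absorbs the others. *)
Lemma resolvent_bound z : z <> 0 -> exists C, 0 <= C /\
  forall v, l2 v -> let y := vplus v (vscal (- z) (jac v)) in
  dot v v <= C * (dot y y + v O ^ 2).
Proof.
intros Hz.
assert (Pz : 0 < Rabs z) by now apply Rabs_pos_lt.
(* With this [e], [neighbours_bound] makes [2 z^2] times the squared norm of the tail of [jac v] at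
   most half of [dot v v], which the left side absorbs. *)
set (e := / (4 * Rabs z)).
assert (He : 0 < e) by (apply Rinv_0_lt_compat; lra).
assert (Eze : z ^ 2 * e ^ 2 = / 16).
{ unfold e. rewrite <- (pow2_abs z). field. lra. }
destruct (s_lim e He) as [n Hn].
destruct (forward_bound z Hz n) as [C [HC HF]].
assert (Pn := pos_INR (S n)).
exists (2 * (INR (S n) * C + 2)). split; [nra|].
intros v Hv y.
assert (Ly : l2 y) by (unfold y; auto using l2_plus, l2_scal, l2_jac).
set (Q := dot y y + v O ^ 2).
assert (HQ : 0 <= Q) by (unfold Q; generalize (dot_self_nonneg y Ly); nra).
(* The rows of [jac v] beyond [n], where all entries of the matrix are at most [e]. *)
set (t := fun i => if (i <=? n)%nat then 0 else jac v i).
destruct (neighbours_bound e t v) as [Lt Dt]; [lra|easy| |].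
{ intros i. unfold t. destruct (Nat.leb_spec i n) as [L|L].
  - rewrite Rabs_R0. generalize (Rabs_pos (v (S i))) (Rabs_pos (shiftr v i)). nra.
  - now apply jac_coord_le with n. }
assert (S1 := Series_indicator (C * Q) n).
assert (S2 : ex_series (fun i => 2 * (y i * y i))) by now apply ex_series_Rscal, l2_mult.
assert (S3 : ex_series (fun i => 2 * z ^ 2 * (t i * t i))) by now apply ex_series_Rscal, l2_mult.
assert (E1 : ex_series (fun i => if (i <=? n)%nat then C * Q else 0)) by (eexists; exact S1).
assert (B : dot v v <= INR (S n) * (C * Q) + 2 * dot y y + 2 * z ^ 2 * dot t t).
{ unfold dot. rewrite <- (is_series_unique _ _ S1), <- !Series_scal_l, <- !Series_plus;
    auto using ex_series_Rplus.
  apply Series_le; [|auto using ex_series_Rplus].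
  intros i. split; [nra|]. unfold t.
  destruct (Nat.leb_spec i n) as [L|L].
  - assert (H := HF v Hv i L). simpl in H. fold y in H. unfold Q. simpl. nra.
  - assert (E : v i = y i + z * jac v i) by (unfold y, vplus, vscal; ring).
    rewrite E. generalize (pow2_ge_0 (y i - z * jac v i)). nra. }
assert (dot y y <= Q) by (unfold Q; nra).
assert (2 * z ^ 2 * dot t t <= / 2 * dot v v).
{ apply Rle_trans with (2 * z ^ 2 * (4 * e ^ 2 * dot v v)).
  - apply Rmult_le_compat_l; [nra|easy].
  - right. replace (2 * z ^ 2 * (4 * e ^ 2 * dot v v)) with (8 * (z ^ 2 * e ^ 2) * dot v v) by ring.
    rewrite Eze. field. }
fold Q. lra.
Qed.

End Jacobi.

(** * Expansion of the moments in eigenvectors *)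

(** For [N m] the squared norm of [A^m w], the last expression is the squared norm of
    [(A^2 - rho) A^m w], so [A^m w] becomes an approximate eigenvector of [A^2]. Here [rho] is the
    supremum of the ratios of consecutive terms; log-convexity keeps every [N m] positive. *)
Lemma log_convex_ratio_sup (N : nat -> R) (M lam : R) :
  0 < lam -> (forall m, 0 <= N m) ->
  (forall m, N (S m) ^ 2 <= N m * N (S (S m))) ->
  (forall m, N (S m) <= M * N m) ->
  lam * N O < N 1%nat ->
  exists rho, lam < rho /\ forall e, 0 < e -> exists m, 0 < N m /\
    N (S (S m)) - 2 * rho * N (S m) + rho ^ 2 * N m <= e * N m.
Proof.
intros Hl Hpos Hconv HM H0.
assert (P : forall m, 0 < N m /\ 0 < N (S m)).
{ induction m as [|m [IH1 IH2]].
  - specialize (HM O). destruct (Hpos O) as [H|E].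
    + split; [easy|]. apply Rlt_trans with (2 := H0). now apply Rmult_lt_0_compat.
    + rewrite <- E in HM, H0. lra.
  - split; [easy|]. specialize (Hconv m).
    destruct (Hpos (S (S m))) as [|E]; [easy|]. rewrite <- E in Hconv. nra. }
set (r := fun m => N (S m) / N m).
assert (Hr : forall m, N (S m) = r m * N m).
{ intros m. unfold r. field. apply Rgt_not_eq, P. }
assert (Bd : bound (fun x => exists m, x = r m)).
{ exists M. intros x [m ->]. apply Rmult_le_reg_r with (N m); [apply P|].
  rewrite <- Hr. apply HM. }
destruct (completeness _ Bd) as [rho [Hub Hlub]]; [now exists (r O), O|].
assert (Hle : forall m, r m <= rho) by (intros m; apply Hub; now exists m).
exists rho. assert (L : lam < rho).
{ apply Rlt_le_trans with (2 := Hle O).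
  apply Rmult_lt_reg_r with (N O); [apply P|]. rewrite <- Hr. exact H0. }
split; [easy|]. intros e He.
(* After division by [N m] the expression is at most [2 rho^2 - 2 rho r m], because both ratios are
   at most [rho]; the tolerance [e / (2 * rho)] turns this into [e]. *)
assert (X : exists m, rho - e / (2 * rho) < r m).
{ apply Classical_Prop.NNPP. intros Hn.
  assert (rho <= rho - e / (2 * rho)).
  { apply Hlub. intros x [m ->]. apply Rnot_lt_le. intros Hx. apply Hn. now exists m. }
  assert (0 < e / (2 * rho)) by (apply Rdiv_lt_0_compat; lra). lra. }
destruct X as [m Hm]. exists m. split; [apply P|].
rewrite (Hr (S m)), (Hr m).
assert (Pm := proj1 (P m)).
assert (R0 : 0 <= r m) by (apply Rlt_le, Rdiv_lt_0_compat; apply P).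
assert (r (S m) * r m <= rho * rho).
{ apply Rle_trans with (rho * r m).
  - apply Rmult_le_compat_r; [easy|apply Hle].
  - apply Rmult_le_compat_l; [lra|apply Hle]. }
assert (2 * rho * rho - 2 * rho * r m <= e).
{ apply Rmult_lt_compat_l with (r := 2 * rho) in Hm; [|lra].
  replace (2 * rho * (rho - e / (2 * rho))) with (2 * rho * rho - e) in Hm by (field; lra).
  lra. }
nra.
Qed.

Section Spectral.

Variable s : nat -> R.
Hypothesis s_pos : forall i, 0 < s i.
Hypothesis s_lim : forall e, 0 < e -> exists n, forall i, (n <= i)%nat -> s i <= e.

Notation A := (jac s).

Fixpoint jacn (m : nat) (v : nat -> R) : nat -> R :=
  match m with O => v | S k => A (jacn k v) end.

Lemma l2_jacn m v : l2 v -> l2 (jacn m v).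
Proof. intros Hv. induction m; [easy|]. simpl. now apply l2_jac. Qed.

Lemma jacn_lincomb m a v b w i :
  jacn m (vplus (vscal a v) (vscal b w)) i = vplus (vscal a (jacn m v)) (vscal b (jacn m w)) i.
Proof.
revert i. induction m as [|m IH]; [easy|]. intros i. simpl.
rewrite (jac_ext _ _ _ IH), jac_plus. unfold vplus. now rewrite !jac_scal.
Qed.

(** Moving one factor [A] across the product pairs [A^m v] with [A^(m+2) v]. *)
Lemma jacn_norm_log_convex m v : l2 v ->
  dot (jacn (S m) v) (jacn (S m) v) ^ 2 <=
  dot (jacn m v) (jacn m v) * dot (jacn (S (S m)) v) (jacn (S (S m)) v).
Proof.
intros Hv. simpl jacn.
rewrite jac_sym at 1; auto using l2_jacn, l2_jac.
apply Cauchy_Schwarz; auto using l2_jacn, l2_jac.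
Qed.

Lemma jacn_square_eigen m c v : (forall i, A (A v) i = c * v i) ->
  forall i, A (A (jacn m v)) i = c * jacn m v i.
Proof.
intros H. induction m as [|m IH]; [easy|]. intros i. simpl.
rewrite (jac_ext _ _ (vscal c (jacn m v))) by exact IH.
now rewrite jac_scal.
Qed.

(** Asking only for an eigenvector of [A^2] admits the sum of two eigenvectors of [A] with opposite
    eigenvalues. *)
Lemma dot_jacn_square_eigen m c v w : l2 v -> l2 w -> (forall i, A (A v) i = c * v i) ->
  dot (jacn m w) (jacn m v) = c ^ m * dot w v.
Proof.
intros Hv Hw H. induction m as [|m IH]; simpl; [ring|].
rewrite jac_sym; auto using l2_jacn, l2_jac.
rewrite (dot_ext _ (jacn m w) _ (vscal c (jacn m v))); [|easy|].
- rewrite dot_scal_r, IH. ring.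
- intros i. now apply jacn_square_eigen.
Qed.

Lemma dot_jacn_eigen m c v w : l2 v -> l2 w -> (forall i, A v i = c * v i) ->
  dot (jacn m w) v = c ^ m * dot w v.
Proof.
intros Hv Hw H. induction m as [|m IH]; simpl; [ring|].
rewrite jac_sym; auto using l2_jacn.
rewrite (dot_ext _ (jacn m w) _ (vscal c v)); [|easy|exact H].
rewrite dot_scal_r, IH. ring.
Qed.

(** * Solutions of [(1 - z A) u = F e_0]: orthogonality, coercivity and moments *)

Variable u : R -> nat -> R.
Variable F : R -> R.
Hypothesis u_l2 : forall z, l2 (u z).
Hypothesis u_eq : forall z i, u z i - z * A (u z) i = F z * basis0 i.
Hypothesis F_even : forall z, F (- z) = F z.
Hypothesis u_even : forall z, u (- z) O = u z O.
Hypothesis u_norm_even : forall z, dot (u (- z)) (u (- z)) = dot (u z) (u z).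
Hypothesis u_nondeg : forall z, F z = 0 -> u z O <> 0.

Local Hint Resolve l2_jac l2_jacn u_l2 l2_plus l2_scal l2_basis0 : core.

(** By symmetry [1 - z A] can be moved onto [u z], which it maps to [F z] times [basis0]. *)
Lemma dot_resolvent z v : l2 v ->
  dot (vplus v (vscal (- z) (A v))) (u z) = F z * v O.
Proof.
intros Hv.
rewrite dot_plus_l, dot_scal_l, jac_sym; auto.
rewrite <- dot_scal_r, <- dot_plus_r; auto.
rewrite (dot_ext _ v _ (vscal (F z) basis0)); [|easy|].
- now rewrite dot_scal_r, dot_basis0_r.
- intros i. unfold vplus, vscal. rewrite <- u_eq. ring.
Qed.

(** Apply [dot_resolvent] to [u z] at [t] and to [u t] at [z]; the combination with factors [z] and
    [t] eliminates the term containing [A]. *)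
Lemma Christoffel_Darboux z t :
  z * F t * u z O - t * F z * u t O = (z - t) * dot (u z) (u t).
Proof.
assert (H1 := dot_resolvent t (u z) (u_l2 z)).
assert (H2 := dot_resolvent z (u t) (u_l2 t)).
rewrite dot_plus_l, dot_scal_l in H1, H2; auto.
rewrite (dot_comm (u t) (u z)), (dot_comm (A (u t))), <- jac_sym in H2; auto.
replace (z * F t * u z O) with (z * (F t * u z O)) by ring.
replace (t * F z * u t O) with (t * (F z * u t O)) by ring.
rewrite <- H1, <- H2. ring.
Qed.

Lemma eigen z : z <> 0 -> F z = 0 -> forall i, A (u z) i = / z * u z i.
Proof.
intros Hz HF i. assert (E := u_eq z i). rewrite HF in E.
apply Rmult_eq_reg_l with z; [|easy].
rewrite <- Rmult_assoc, Rinv_r by easy. lra.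
Qed.

Lemma eigen_orth z t : z <> t -> F z = 0 -> F t = 0 -> dot (u z) (u t) = 0.
Proof.
intros Hzt Hz Ht. assert (H := Christoffel_Darboux z t). rewrite Hz, Ht in H.
apply Rmult_eq_reg_l with (z - t); [|lra]. lra.
Qed.

Lemma eigen_norm_pos z : F z = 0 -> 0 < dot (u z) (u z).
Proof. intros H. apply dot_self_pos with O; auto. Qed.

(** [1 - z A] is bounded below on the orthogonal complement of [u z] when [u z] is in its kernel,
    and on the whole space when [F z] is nonzero. What remains after [resolvent_bound] is to remove
    [v O] from the estimate. *)
Lemma coercive z : z <> 0 -> exists C, 0 <= C /\
  forall v, l2 v -> (F z = 0 -> dot v (u z) = 0) ->
  let y := vplus v (vscal (- z) (A v)) in
  dot v v <= C * dot y y.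
Proof.
intros Hz. destruct (resolvent_bound s s_pos s_lim z Hz) as [C [HC H]].
destruct (Req_dec (F z) 0) as [E|E].
- exists C. split; [easy|]. intros v Hv Hvu y. specialize (Hvu E).
  (* Adding this multiple of the kernel vector [u z] makes coordinate 0 vanish without changing [y];
     by orthogonality it can only increase the norm of [v]. *)
  set (c := - (v O / u z O)).
  set (v' := vplus (vscal 1 v) (vscal c (u z))).
  assert (Hv' : l2 v') by (unfold v'; auto).
  assert (E0 : v' O = 0).
  { unfold v', vplus, vscal, c. field. now apply u_nondeg. }
  assert (H' := H v' Hv'). simpl in H'. rewrite E0 in H'.
  assert (Ey : forall i, vplus v' (vscal (- z) (A v')) i = y i).
  { intros i. change (v' i + - z * A v' i = v i + - z * A v i). unfold v'. rewrite jac_plus.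
    unfold vplus. rewrite !jac_scal. unfold vscal. rewrite (eigen z Hz E). now field. }
  rewrite (dot_ext _ _ _ _ Ey Ey) in H'.
  unfold v' in H'. rewrite dot_self_lincomb, Hvu in H'; auto.
  generalize (eigen_norm_pos z E) (pow2_ge_0 c); intros.
  assert (0 <= c ^ 2 * dot (u z) (u z)) by (apply Rmult_le_pos; lra).
  replace (0 * (0 * 1)) with 0 in H' by ring. lra.
(* Here [y] controls [v O], since [dot_resolvent] gives [F z * v O = dot y (u z)]. *)
- set (D := dot (u z) (u z) / F z ^ 2).
  assert (PF : 0 < F z ^ 2) by nra.
  assert (HD : 0 <= D).
  { apply Rmult_le_pos; [now apply dot_self_nonneg|now apply Rlt_le, Rinv_0_lt_compat]. }
  exists (C * (1 + D)). split; [apply Rmult_le_pos; lra|].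
  intros v Hv _ y.
  assert (Hy : l2 y) by (unfold y; auto).
  assert (H' := H v Hv). simpl in H'. fold y in H'.
  apply Rle_trans with (1 := H'). rewrite Rmult_assoc. apply Rmult_le_compat_l; [easy|].
  assert (v O ^ 2 <= D * dot y y); [|simpl in *; lra].
  apply Rmult_le_reg_l with (1 := PF).
  replace (F z ^ 2 * v O ^ 2) with ((F z * v O) ^ 2) by ring.
  rewrite <- dot_resolvent by easy. fold y.
  apply Rle_trans with (1 := Cauchy_Schwarz _ _ Hy (u_l2 z)).
  right. unfold D. field. exact E.
Qed.

(** The Neumann series of [(1 - z A)^-1] at [basis0], with exact remainder and multiplied by [F z]
    so that it also holds at zeros of [F]. It iterates [dot_resolvent] on the vectors [A^k e_0]. *)
Lemma G_expansion z m :
  u z O = F z * sum_n (fun k => z ^ k * jacn k basis0 O) m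
          + z ^ (S m) * dot (jacn (S m) basis0) (u z).
Proof.
assert (St : forall k, dot (jacn k basis0) (u z) =
   F z * jacn k basis0 O + z * dot (jacn (S k) basis0) (u z)).
{ intros k. rewrite <- dot_resolvent by auto.
  rewrite dot_plus_l, dot_scal_l by auto. simpl. ring. }
induction m as [|m IH].
- rewrite sum_O. rewrite <- (dot_basis0_l (u z)). rewrite (St O) at 1. simpl. ring.
- rewrite IH at 1. rewrite sum_S_R, (St (S m)). simpl. ring.
Qed.

(** The diagonal of [A] is zero, so [A] exchanges sequences supported on even and on odd indices. *)
Lemma jacn_basis0_parity k i : Nat.odd (k + i) = true -> jacn k basis0 i = 0.
Proof.
revert i. induction k as [|k IH]; intros i H.
- destruct i; [easy|reflexivity].
- simpl. unfold jac. rewrite (IH (S i)) by (rewrite <- H; f_equal; lia).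
  destruct i as [|i]; simpl; [ring|]. rewrite (IH i); [ring|].
  replace (S k + S i)%nat with (S (S (k + i))) in H by lia. exact H.
Qed.

Lemma jacn_add j k v : jacn (j + k) v = jacn j (jacn k v).
Proof. induction j as [|j IH]; [easy|]. simpl. now rewrite IH. Qed.

Lemma dot_jacn_move m v w : l2 v -> l2 w -> dot (jacn m v) w = dot v (jacn m w).
Proof.
intros Hv. revert w. induction m as [|m IH]; intros w Hw; [easy|].
simpl. rewrite jac_sym by auto. rewrite IH by auto.
f_equal. change (A w) with (jacn 1 w). now rewrite <- jacn_add, Nat.add_comm.
Qed.

(** The moment of order [2 m] of the spectral measure of [A] at [basis0], written as a squared norm
    so that Parseval's identity applies to it. *)
Definition moment (m : nat) : R := dot (jacn m basis0) (jacn m basis0).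

Lemma moment_even m : jacn (2 * m) basis0 O = moment m.
Proof.
unfold moment. rewrite <- (dot_basis0_l (jacn _ _)).
replace (2 * m)%nat with (m + m)%nat by lia.
rewrite jacn_add, <- dot_jacn_move; auto.
Qed.

(** Odd terms of [G_expansion] vanish by parity, and its remainder tends to 0 for small [z] because
    [A] is bounded. *)
Lemma moment_generating : exists r, 0 < r /\ forall z, 0 < z < r ->
  F z <> 0 /\ is_series (fun m => moment m * (z ^ 2) ^ m) (u z O / F z).
Proof.
destruct (jac_bounded s s_pos s_lim) as [M [HM HA]].
assert (Hn : forall m, moment m <= M ^ m).
{ induction m as [|m IH].
  - unfold moment. simpl. rewrite dot_basis0_l. simpl. lra.
  - unfold moment in *. simpl. apply Rle_trans with (1 := proj2 (HA _ (l2_jacn m _ l2_basis0))).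
    apply Rmult_le_compat_l; lra. }
assert (PM : 0 < M + 1) by lra.
(* This radius ensures both [z < 1] and [z^2 M < 1]. *)
exists (/ (M + 1)). split; [now apply Rinv_0_lt_compat|].
intros z Hz.
set (q := z ^ 2 * M).
assert (Hz1 : z * (M + 1) < 1).
{ apply Rmult_lt_reg_r with (/ (M + 1)); [now apply Rinv_0_lt_compat|].
  rewrite Rmult_assoc, Rinv_r; lra. }
assert (Hq : 0 <= q < 1).
{ unfold q. split; [nra|]. assert (z < 1) by nra. nra. }
set (rem := fun m => z ^ (S (2 * m)) * dot (jacn (S (2 * m)) basis0) (u z)).
assert (Hsum : forall m, u z O = F z * sum_n (fun k => moment k * (z ^ 2) ^ k) m + rem m).
{ intros m. rewrite (G_expansion z (2 * m)). unfold rem. f_equal. f_equal.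
  induction m as [|m IH].
  - rewrite !sum_O. change (jacn 0 basis0 O) with (jacn (2 * 0) basis0 O).
    rewrite moment_even. simpl. ring.
  - replace (2 * S m)%nat with (S (S (2 * m))) by lia.
    rewrite !sum_S_R, IH.
    rewrite (jacn_basis0_parity (S (2 * m)) O).
    2: { rewrite Nat.add_0_r, Nat.odd_succ, Nat.even_mul. easy. }
    replace (S (S (2 * m))) with (2 * S m)%nat by lia.
    rewrite moment_even, pow_mult.
    set (x := sum_n _ m : R). change (x + z ^ S (2 * m) * 0 + (z ^ 2) ^ S m * moment (S m) = x + moment (S m) * (z ^ 2) ^ S m).
    ring. }
assert (Ha : 0 <= z ^ 2 * M * dot (u z) (u z)).
{ apply Rmult_le_pos; [apply Hq|now apply dot_self_nonneg]. }
assert (Hrem : is_lim_seq rem 0).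
{ apply is_lim_seq_abs_0.
  (* Cauchy-Schwarz bounds the square of the remainder by [a q^(2m)] with
     [a = z^2 M dot (u z) (u z)]; the factor [a + 1] satisfies [a <= (a + 1)^2] and avoids a square
     root. *)
  apply is_lim_seq_le_le with (fun _ => 0) (fun m => (z ^ 2 * M * dot (u z) (u z) + 1) * q ^ m).
  - intros m. split; [apply Rabs_pos|].
    apply Rsqr_incr_0_var.
    2: { apply Rmult_le_pos; [lra|apply pow_le; lra]. }
    rewrite <- Rsqr_abs. unfold rem, Rsqr.
    set (d := dot (jacn (S (2 * m)) basis0) (u z)).
    assert (Hd : d ^ 2 <= M ^ (S (2 * m)) * dot (u z) (u z)).
    { apply Rle_trans with (1 := Cauchy_Schwarz _ _ (l2_jacn _ _ l2_basis0) (u_l2 z)).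
      apply Rmult_le_compat_r; [now apply dot_self_nonneg|apply Hn]. }
    replace (z ^ S (2 * m) * d * (z ^ S (2 * m) * d)) with ((z ^ S (2 * m)) ^ 2 * d ^ 2) by ring.
    apply Rle_trans with ((z ^ S (2 * m)) ^ 2 * (M ^ (S (2 * m)) * dot (u z) (u z))).
    { apply Rmult_le_compat_l; [apply pow2_ge_0|easy]. }
    replace ((z ^ S (2 * m)) ^ 2 * (M ^ (S (2 * m)) * dot (u z) (u z)))
      with ((z ^ 2 * M * dot (u z) (u z)) * (q ^ m * q ^ m)).
    2: { unfold q. rewrite Rpow_mult_distr, <- pow_mult, <- !tech_pow_Rmult.
         replace (2 * m)%nat with (m + m)%nat by lia. rewrite !pow_add. ring. }
    set (a := z ^ 2 * M * dot (u z) (u z)) in *.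
    replace ((a + 1) * q ^ m * ((a + 1) * q ^ m)) with ((a + 1) ^ 2 * (q ^ m * q ^ m)) by ring.
    apply Rmult_le_compat_r; [|nra].
    apply Rmult_le_pos; apply pow_le; lra.
  - apply is_lim_seq_const.
  - replace (Finite 0) with (Rbar_mult (z ^ 2 * M * dot (u z) (u z) + 1) 0)
      by (simpl; f_equal; ring).
    apply is_lim_seq_scal_l. apply is_lim_seq_geom. rewrite Rabs_pos_eq; lra. }
assert (HF : F z <> 0).
(* If [F z] vanished, every remainder would equal [u z O], which is nonzero, although the remainders
   tend to 0. *)
{ intros E. apply (u_nondeg z E).
  assert (Hl : is_lim_seq rem (u z O)).
  { apply is_lim_seq_ext with (fun _ => u z O); [|apply is_lim_seq_const].
    intros m. rewrite (Hsum m), E at 1. ring. }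
  apply is_lim_seq_unique in Hl. apply is_lim_seq_unique in Hrem.
  rewrite Hrem in Hl. now injection Hl. }
split; [easy|].
change (is_lim_seq (sum_n (fun m => moment m * (z ^ 2) ^ m)) (u z O / F z)).
apply (is_lim_seq_ext (fun m => (u z O - rem m) / F z)).
- intros m. rewrite (Hsum m) at 1.
  set (x := sum_n _ m : R). change ((F z * x + rem m - rem m) / F z = x). now field.
- replace (Finite (u z O / F z)) with (Finite ((u z O - 0) * / F z)) by (f_equal; unfold Rdiv; ring).
  apply is_lim_seq_mult'; [|apply is_lim_seq_const].
  apply is_lim_seq_minus'; [apply is_lim_seq_const|exact Hrem].
Qed.

(** * Projection away from the first eigenvectors *)

Variable Z : nat -> R.
Hypothesis Z_pos : forall k, 0 < Z k.
Hypothesis Z_incr : forall k, Z k < Z (S k).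
Hypothesis Z_zeros : forall t, 0 < t -> (F t = 0 <-> exists k, Z k = t).

Lemma Z_lt j k : (j < k)%nat -> Z j < Z k.
Proof.
induction 1 as [|k _ IH]; [apply Z_incr|]. generalize (Z_incr k). lra.
Qed.

Lemma F_Z k : F (Z k) = 0.
Proof. apply Z_zeros; [apply Z_pos|now exists k]. Qed.

Lemma F_opp_Z k : F (- Z k) = 0.
Proof. rewrite F_even. apply F_Z. Qed.

Local Hint Resolve F_Z F_opp_Z : core.

(** By the parity hypotheses [basis0] has the same Fourier coefficient [alpha k] along [u (Z k)] and
    [u (- Z k)], so both are removed at once; [A^2] acts on their sum as [lambda k]. *)
Let U k := vplus (u (Z k)) (u (- Z k)).
Let alpha k := u (Z k) O / dot (u (Z k)) (u (Z k)).
Let lambda k := / Z k ^ 2.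

(* What is left of the first basis vector after projecting away the
   eigenvectors of eigenvalues [± / Z k], [k < K]. *)
Fixpoint remainder (K : nat) : nat -> R :=
  match K with
  | O => basis0
  | S k => vplus (vscal 1 (remainder k)) (vscal (- alpha k) (U k))
  end.

Lemma l2_U k : l2 (U k).
Proof. unfold U; auto. Qed.

Lemma l2_remainder K : l2 (remainder K).
Proof. induction K; simpl; auto using l2_U. Qed.

Local Hint Resolve l2_U l2_remainder : core.

Lemma Z_neq j k : j <> k -> Z j <> Z k.
Proof.
intros H. destruct (Nat.lt_gt_cases j k) as [[L|L] _]; [easy|generalize (Z_lt _ _ L); lra..].
Qed.

Lemma dot_U_self k : dot (U k) (U k) = 2 * dot (u (Z k)) (u (Z k)).
Proof.
assert (O : dot (u (Z k)) (u (- Z k)) = 0) by (apply eigen_orth; auto; generalize (Z_pos k); lra).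
unfold U. rewrite dot_plus_l, !dot_plus_r, u_norm_even, (dot_comm (u (- _)) (u (Z k))), O; auto.
ring.
Qed.

(** Eigenvectors at distinct zeros are orthogonal, so step [K] alters only the products with
    [u (Z K)] and [u (- Z K)], which [alpha K] cancels. *)
Lemma dot_remainder K k t : t = Z k \/ t = - Z k ->
  dot (remainder K) (u t) = if (k <? K)%nat then 0 else u t O.
Proof.
intros Ht.
assert (HFt : F t = 0) by (destruct Ht as [->| ->]; auto).
assert (Pk := Z_pos k).
induction K as [|K IH]; [apply dot_basis0_l|].
assert (PK := Z_pos K).
simpl remainder. rewrite dot_plus_l, !dot_scal_l, IH by auto.
unfold U at 1. rewrite dot_plus_l by auto.
destruct (Nat.eq_dec k K) as [->|Ne].
- rewrite (proj2 (Nat.ltb_ge K K)), (proj2 (Nat.ltb_lt K (S K))) by lia.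
  assert (E : dot (u (Z K)) (u t) + dot (u (- Z K)) (u t) = dot (u (Z K)) (u (Z K)) /\ u t O = u (Z K) O).
  { destruct Ht as [->| ->].
    - rewrite (eigen_orth (- Z K)); auto; [|lra]. split; ring.
    - rewrite (eigen_orth (Z K)), u_norm_even; auto; [|lra]. split; [ring|apply u_even]. }
  destruct E as [E1 E2]. rewrite E1, E2. unfold alpha. field.
  apply Rgt_not_eq, eigen_norm_pos; auto.
- assert (N1 := Z_neq _ _ Ne).
  rewrite (eigen_orth (Z K)), (eigen_orth (- Z K)); auto.
  2, 3: destruct Ht as [->| ->]; lra.
  replace (k <? S K)%nat with (k <? K)%nat; [ring|].
  destruct (Nat.ltb_spec k K), (Nat.ltb_spec k (S K)); lia || easy.
Qed.

Lemma square_eigen_U k i : A (A (U k)) i = lambda k * U k i.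
Proof.
assert (Pk := Z_pos k).
assert (E1 := eigen (Z k) ltac:(lra) (F_Z k)).
assert (E2 := eigen (- Z k) ltac:(lra) (F_opp_Z k)).
rewrite (jac_ext s _ (vplus (vscal (/ Z k) (u (Z k))) (vscal (/ - Z k) (u (- Z k))))).
- rewrite jac_plus. unfold vplus. rewrite !jac_scal. unfold vscal. rewrite E1, E2.
  unfold U, vplus, lambda. field. lra.
- intros j. unfold U. rewrite jac_plus. unfold vplus, vscal. now rewrite E1, E2.
Qed.

Definition residual (m K : nat) : R :=
  dot (jacn m (remainder K)) (jacn m (remainder K)).

(** The total mass that the spectral measure at [basis0] gives to the two eigenvalues [± / Z k]. *)
Definition weight (k : nat) : R :=
  2 * u (Z k) O ^ 2 / dot (u (Z k)) (u (Z k)).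

(** Pythagoras: in the expanded square the cross term is minus twice the term of [U K], whose value
    is [weight K * lambda K ^ m]. *)
Lemma residual_step m K : residual m (S K) = residual m K - weight K * lambda K ^ m.
Proof.
unfold residual. simpl remainder.
rewrite (dot_ext _ _ _ _ (jacn_lincomb m _ _ _ _) (jacn_lincomb m _ _ _ _)).
rewrite dot_self_lincomb by auto.
rewrite !(dot_jacn_square_eigen m (lambda K) (U K)); auto using square_eigen_U.
rewrite dot_U_self. unfold U at 1. rewrite dot_plus_r by auto.
rewrite (dot_remainder K K (Z K)), (dot_remainder K K (- Z K)) by auto.
rewrite Nat.ltb_irrefl, u_even. unfold alpha, weight. field.
apply Rgt_not_eq, eigen_norm_pos; auto.
Qed.

Lemma residual_sum m K :
  sum_n (fun k => weight k * lambda k ^ m) K = moment m - residual m (S K) :> R.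
Proof.
induction K as [|K IH].
- rewrite sum_O, residual_step. unfold moment, residual. simpl remainder.
  set (a := weight 0 * lambda 0 ^ m). ring.
- rewrite sum_S_R, IH, (residual_step m (S K)). ring.
Qed.

Lemma weight_nonneg k : 0 <= weight k.
Proof.
apply Rmult_le_pos; [nra|]. apply Rlt_le, Rinv_0_lt_compat, eigen_norm_pos; auto.
Qed.

Lemma residual_nonneg m K : 0 <= residual m K.
Proof. apply dot_self_nonneg; auto. Qed.

Lemma lambda_pos k : 0 < lambda k.
Proof. apply Rinv_0_lt_compat. generalize (Z_pos k). nra. Qed.

Lemma residual0_le_1 K : residual 0 K <= 1.
Proof.
induction K as [|K IH].
- unfold residual. simpl. rewrite dot_basis0_l. simpl. lra.
- rewrite residual_step. generalize (weight_nonneg K). simpl. lra.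
Qed.

(* If the growth rate [rho] of [jacn m (remainder K)] exceeded [lambda K], then
   [1 - jac^2 / rho] would not be bounded below on the orthogonal complement
   of the first [K] pairs of eigenvectors. *)
Lemma residual_decay m K : residual (S m) K <= lambda K * residual m K.
Proof.
apply Rnot_lt_le. intros Hm.
destruct (jac_bounded s s_pos s_lim) as [M [HM HA]].
destruct (log_convex_ratio_sup (fun i => residual (i + m) K) M (lambda K)) as [rho [Hrho Hsmall]].
- apply lambda_pos.
- intros; apply residual_nonneg.
- intros i. apply jacn_norm_log_convex; auto.
- intros i. now apply HA; auto.
- exact Hm.
- assert (Pl := lambda_pos K).
  assert (Hs := sqrt_lt_R0 rho ltac:(lra)).
  set (z := / sqrt rho).
  assert (Hz : 0 < z) by now apply Rinv_0_lt_compat.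
  assert (Ez : z ^ 2 * rho = 1).
  { unfold z. rewrite pow_inv, pow2_sqrt by lra. field. lra. }
  (* Since [rho] exceeds [lambda K], a zero of [F] at [z] precedes [Z K], so its eigenvectors have
     already been projected away. *)
  assert (HzK : z < Z K).
  { apply Rnot_le_lt. intros L. assert (PK := Z_pos K).
    assert (1 <= z ^ 2 * lambda K).
    { unfold lambda. apply Rmult_le_reg_r with (Z K ^ 2); [nra|].
      rewrite Rmult_assoc, Rinv_l by nra. nra. }
    nra. }
  assert (Hperp : forall i t, t = z \/ t = - z -> F t = 0 -> dot (jacn i (remainder K)) (u t) = 0).
  { intros i t Ht HF.
    assert (HFz : F z = 0) by (destruct Ht as [->| ->]; [easy|now rewrite <- F_even]).
    destruct (proj1 (Z_zeros z Hz) HFz) as [k Ek].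
    rewrite (dot_jacn_eigen i (/ t)); auto.
    2: { apply eigen; [destruct Ht; lra|easy]. }
    rewrite (dot_remainder K k t) by (rewrite Ek; exact Ht).
    rewrite (proj2 (Nat.ltb_lt k K)); [ring|].
    destruct (le_lt_dec K k) as [L|L]; [|easy].
    exfalso. destruct (proj1 (Nat.lt_eq_cases K k) L) as [L'| ->].
    - generalize (Z_lt _ _ L'). lra.
    - lra. }
  (* The factors of [1 - z^2 A^2 = (1 + z A) (1 - z A)] are bounded below in turn. *)
  destruct (coercive z ltac:(lra)) as [C1 [HC1 H1]].
  destruct (coercive (- z) ltac:(lra)) as [C2 [HC2 H2]].
  set (c := C1 * C2 * z ^ 4).
  assert (Hc : 0 <= c).
  { apply Rmult_le_pos; [now apply Rmult_le_pos|]. apply pow_le; lra. }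
  (* With this tolerance coercivity yields [N <= c / (c + 1) * N] for a positive [N], a
     contradiction. *)
  destruct (Hsmall (/ (c + 1))) as [i [Pi Hi]]; [apply Rinv_0_lt_compat; lra|].
  set (v := jacn (i + m) (remainder K)).
  set (y := vplus v (vscal (- z) (A v))).
  set (y' := vplus y (vscal (- - z) (A y))).
  assert (Lv : l2 v) by (unfold v; auto).
  assert (Ly : l2 y) by (unfold y; auto).
  assert (B1 := H1 v Lv (Hperp _ z ltac:(auto))). simpl in B1. fold y in B1.
  assert (B2 : dot y y <= C2 * dot y' y').
  { apply H2; [easy|]. intros HF.
    unfold y. rewrite dot_plus_l, dot_scal_l by auto.
    change (A v) with (jacn (S (i + m)) (remainder K)).
    rewrite Hperp by auto. unfold v. rewrite Hperp by auto. ring. }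
  assert (E : dot y' y' = residual (i + m) K - 2 * z ^ 2 * residual (S i + m) K + z ^ 4 * residual (S (S i) + m) K).
  { rewrite (dot_ext _ (vplus (vscal 1 v) (vscal (- z ^ 2) (A (A v)))) _
      (vplus (vscal 1 v) (vscal (- z ^ 2) (A (A v))))).
    2, 3: intros k; change (v k + - z * A v k + - - z * A y k = 1 * v k + - z ^ 2 * A (A v) k);
      unfold y; rewrite jac_plus; unfold vplus; rewrite jac_scal; unfold vscal; ring.
    rewrite dot_self_lincomb by auto.
    rewrite <- (jac_sym s s_pos s_lim v (A v)) by auto.
    unfold residual, v. simpl. ring. }
  (* As [z^2 rho = 1], this is [z^4] times the squared norm of [(A^2 - rho) v]. *)
  assert (E' : dot y' y' = z ^ 4 * (residual (S (S i) + m) K - 2 * rho * residual (S i + m) K + rho ^ 2 * residual (i + m) K)).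
  { rewrite E.
    replace (z ^ 4 * (residual (S (S i) + m) K - 2 * rho * residual (S i + m) K + rho ^ 2 * residual (i + m) K))
    with (z ^ 4 * residual (S (S i) + m) K - 2 * z ^ 2 * (z ^ 2 * rho) * residual (S i + m) K
      + (z ^ 2 * rho) ^ 2 * residual (i + m) K) by ring.
    rewrite Ez. ring. }
  change (dot v v) with (residual (i + m) K) in B1.
  set (N := residual (i + m) K) in *.
  assert (B3 : N <= c * (/ (c + 1) * N)).
  { apply Rle_trans with (1 := B1).
    apply Rle_trans with (C1 * (C2 * dot y' y')).
    - now apply Rmult_le_compat_l.
    - rewrite E'. rewrite <- !Rmult_assoc, (Rmult_assoc c).
      now apply Rmult_le_compat_l. }
  assert (c * / (c + 1) < 1).
  { apply Rmult_lt_reg_r with (c + 1); [lra|]. rewrite Rmult_assoc, Rinv_l; lra. }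
  change (0 < N) in Pi. nra.
Qed.

(** * Completeness of the eigenvectors *)

Hypothesis F_cont : forall z, continuous F z.
Hypothesis kernel_cont : forall z, continuous (fun t => dot (u z) (u t)) z.

(** A finite limit [L] of the zeros would be a zero with [u L] orthogonal to every [u (Z k)];
    continuity of the kernel would then make [u L] orthogonal to itself. *)
Lemma Z_unbounded M : exists k, M < Z k.
Proof.
apply Classical_Prop.NNPP. intros Hn.
destruct (growing_cv Z) as [L HL].
- intros k. apply Rlt_le, Z_incr.
- exists M. intros x [k ->]. apply Rnot_lt_le. intros H. apply Hn. now exists k.
- assert (HZL : forall k, Z k < L).
  { intros k. apply Rlt_le_trans with (1 := Z_incr k).
    apply (growing_ineq Z); [intros j; apply Rlt_le, Z_incr|easy]. }
  apply is_lim_seq_Reals in HL.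
  assert (FL : F L = 0).
  { assert (H : is_lim_seq (fun k => F (Z k)) (F L)) by (apply (is_lim_seq_continuous F Z L);
      [now apply continuity_pt_filterlim, F_cont|easy]).
    apply is_lim_seq_unique in H. rewrite (Lim_seq_ext _ (fun _ => 0)), Lim_seq_const in H by apply F_Z.
    now injection H. }
  assert (H : is_lim_seq (fun k => dot (u L) (u (Z k))) (dot (u L) (u L))).
  { apply (is_lim_seq_continuous (fun t => dot (u L) (u t)) Z L); [|easy].
    now apply continuity_pt_filterlim, kernel_cont. }
  apply is_lim_seq_unique in H. rewrite (Lim_seq_ext _ (fun _ => 0)), Lim_seq_const in H.
  + injection H. generalize (eigen_norm_pos L FL). lra.
  + intros k. apply eigen_orth; auto. generalize (HZL k). lra.
Qed.

Lemma lambda_lim : is_lim_seq lambda 0.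
Proof.
assert (H : is_lim_seq Z p_infty).
{ intros P [M HM]. destruct (Z_unbounded M) as [k Hk]. exists k. intros n Hn.
  apply HM. apply Rlt_le_trans with (1 := Hk).
  destruct (proj1 (Nat.lt_eq_cases k n) Hn) as [L| ->]; [apply Rlt_le, Z_lt, L|lra]. }
apply is_lim_seq_ext with (fun k => / (Z k * Z k)).
- intros k. unfold lambda. f_equal. ring.
- apply (is_lim_seq_inv (fun k => Z k * Z k) p_infty); [|easy].
  apply (is_lim_seq_mult Z Z p_infty p_infty p_infty H H). easy.
Qed.

Hypothesis range_dense : forall e, 0 < e -> exists v, l2 v /\
  let d := vplus basis0 (vscal (-1) (A v)) in dot d d <= e.

(** The remainder is an orthogonal projection of [basis0]. In the induction both sides drop by
    [weight K]. *)
Lemma residual0_eq K : residual 0 K = dot (remainder K) basis0.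
Proof.
rewrite dot_basis0_r. induction K as [|K IH].
- unfold residual. simpl. now rewrite dot_basis0_l.
- rewrite residual_step, IH. simpl remainder. unfold vplus, vscal, U, alpha, weight, vplus.
  rewrite u_even. simpl pow. field. apply Rgt_not_eq, eigen_norm_pos; auto.
Qed.

(** Write [basis0 = A v + d] with [d] small. The remainder [w] has norm at most 1, so [dot w d] is
    small, while [dot w (A v) = dot (A w) v] tends to 0 because the squared norm of [A w] is at most
    [lambda K]. *)
Lemma residual0_lim : is_lim_seq (residual 0) 0.
Proof.
apply is_lim_seq_Reals. intros e He.
destruct (range_dense (e ^ 2 / 4)) as [v [Hv Hd]]; [nra|].
set (d := vplus basis0 (vscal (-1) (A v))) in Hd. simpl in Hd. fold d in Hd.
assert (Ld : l2 d) by (unfold d; auto).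
assert (Nv := dot_self_nonneg v Hv).
assert (Hl : is_lim_seq (fun K => lambda K * (dot v v + 1)) 0).
{ replace (Finite 0) with (Finite (0 * (dot v v + 1))) by (f_equal; ring).
  apply is_lim_seq_mult'; [apply lambda_lim|apply is_lim_seq_const]. }
apply is_lim_seq_Reals in Hl.
destruct (Hl (e ^ 2 / 8)) as [K0 HK0]; [nra|].
exists K0. intros K HK. specialize (HK0 K HK). unfold Rdist in *.
rewrite Rminus_0_r in HK0. rewrite Rminus_0_r.
rewrite Rabs_pos_eq by apply residual_nonneg.
apply Rabs_def2 in HK0. destruct HK0 as [HK0 _].
assert (E : residual 0 K = dot (remainder K) d + dot (A (remainder K)) v).
{ rewrite residual0_eq, jac_sym by auto. unfold d.
  rewrite dot_plus_r, dot_scal_r by auto. ring. }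
set (w := remainder K) in *.
assert (C1 := Cauchy_Schwarz w d (l2_remainder K) Ld).
assert (C2 := Cauchy_Schwarz (A w) v (l2_jac s s_pos s_lim _ (l2_remainder K)) Hv).
assert (D1 := residual0_le_1 K). assert (D0 := residual_nonneg 0 K).
assert (D2 := residual_decay 0 K).
change (dot w w) with (residual 0 K) in C1.
change (dot (A w) (A w)) with (residual 1 K) in C2.
assert (Pl := lambda_pos K).
assert (B1 : dot w d ^ 2 <= e ^ 2 / 4).
{ apply Rle_trans with (1 := C1).
  assert (0 <= dot d d) by now apply dot_self_nonneg. nra. }
assert (B2 : dot (A w) v ^ 2 < e ^ 2 / 8).
{ apply Rle_lt_trans with (1 := C2).
  apply Rle_lt_trans with (lambda K * dot v v).
  - apply Rmult_le_compat_r; [easy|]. nra.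
  - nra. }
rewrite E in *.
(* The bounds [e^2 / 4] and [e^2 / 8] on the two squares give at most [3 e^2 / 4] for the square of
   the sum. *)
assert (B3 : (dot w d + dot (A w) v) ^ 2 < e ^ 2).
{ generalize (pow2_ge_0 (dot w d - dot (A w) v)). nra. }
nra.
Qed.

Lemma residual_lim m : is_lim_seq (residual m) 0.
Proof.
induction m as [|m IH]; [apply residual0_lim|].
apply is_lim_seq_le_le with (fun _ => 0) (fun K => lambda K * residual m K).
- intros K. split; [apply residual_nonneg|apply residual_decay].
- apply is_lim_seq_const.
- replace (Finite 0) with (Finite (0 * 0)) by (f_equal; ring).
  apply is_lim_seq_mult'; [apply lambda_lim|exact IH].
Qed.

Lemma moment_series m : is_series (fun k => weight k * (/ Z k ^ 2) ^ m) (moment m).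
Proof.
change (is_lim_seq (sum_n (fun k => weight k * lambda k ^ m)) (moment m)).
apply (is_lim_seq_ext (fun K => moment m - residual m (S K))).
- intros K. symmetry. apply residual_sum.
- replace (Finite (moment m)) with (Finite (moment m - 0)) by (f_equal; ring).
  apply is_lim_seq_minus'; [apply is_lim_seq_const|].
  (* The partial sum through index [K] corresponds to [S K] removed pairs. *)
  apply (is_lim_seq_incr_1 (residual m)), residual_lim.
Qed.

End Spectral.

(** * The eigenvectors built from q-Bessel functions *)

(** Weierstrass M-test: near [z] the tail is uniformly below [e / 4], and the finite part is
    continuous. *)
Lemma continuous_Series_dom (a : nat -> R -> R) (m : nat -> R) (z : R) :
  ex_series m ->
  locally z (fun t => forall i, Rabs (a i t) <= m i) ->
  (forall i, continuous (a i) z) ->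
  continuous (fun t => Series (fun i => a i t)) z.
Proof.
intros Hm Hd Hc. apply filterlim_locally. intros e.
assert (He := cond_pos e).
assert (Hd0 := locally_singleton _ _ Hd).
assert (Htail : exists n, Series (fun k => m (S n + k)%nat) < e / 4).
{ assert (H : is_lim_seq (sum_n m) (Series m)) by exact (Series_correct m Hm).
  apply is_lim_seq_Reals in H. destruct (H (e / 4)) as [n Hn]; [lra|].
  exists n. specialize (Hn n ltac:(lia)). unfold Rdist in Hn.
  rewrite (Series_incr_n m (S n)) in Hn by (lia || easy). simpl pred in Hn.
  rewrite sum_n_Reals in Hn. apply Rabs_def2 in Hn. lra. }
destruct Htail as [n Hn].
assert (Hfin : locally z (fun t => Rabs (sum_n (fun i => a i t) n - sum_n (fun i => a i z) n) < e / 4)).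
{ assert (C : continuous (fun t => sum_n (fun i => a i t) n) z).
  { clear - Hc. induction n as [|n IH].
    - apply (continuous_ext (a O)); [intros; now rewrite sum_O|easy].
    - apply (continuous_ext (fun t => plus (sum_n (fun i => a i t) n) (a (S n) t))).
      + intros; now rewrite sum_Sn.
      + now apply (continuous_plus (V := R_NormedModule)). }
  assert (P : 0 < e / 4) by lra.
  exact (proj1 (filterlim_locally _ _) C (mkposreal _ P)). }
generalize (filter_and _ _ Hd Hfin). apply filter_imp. intros t [Ht1 Ht2].
assert (Ex : forall t, (forall i, Rabs (a i t) <= m i) -> ex_series (fun i => a i t)).
{ intros x Hx. now apply ex_series_dom with m. }
assert (T : forall t, (forall i, Rabs (a i t) <= m i) ->
  Rabs (Series (fun i => a i t) - sum_n (fun i => a i t) n) < e / 4).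
{ intros x Hx. rewrite (Series_incr_n _ (S n)) by (lia || auto). simpl pred.
  rewrite sum_n_Reals.
  replace (sum_f_R0 (fun i => a i x) n + Series (fun k => a (S n + k)%nat x)
    - sum_f_R0 (fun i => a i x) n) with (Series (fun k => a (S n + k)%nat x)) by ring.
  apply Rle_lt_trans with (2 := Hn).
  assert (Em : ex_series (fun k => m (S n + k)%nat)) by now apply (proj1 (ex_series_incr_n m (S n))).
  apply Rle_trans with (Series (fun k => Rabs (a (S n + k)%nat x))).
  - apply Series_Rabs. apply ex_series_dom with (2 := Em). intros. now rewrite Rabs_Rabsolu.
  - apply Series_le; [|easy]. intros k. split; [apply Rabs_pos|apply Hx]. }
assert (T1 := T t Ht1). assert (T2 := T z Hd0).
change (Rabs (Series (fun i => a i t) - Series (fun i => a i z)) < e).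
apply Rabs_def2 in T1. apply Rabs_def2 in T2. apply Rabs_def2 in Ht2.
apply Rabs_def1; lra.
Qed.

Lemma qpoch_pos a p n : 0 < p < 1 -> a < 1 -> 0 < qpoch a p n.
Proof.
intros Hp Ha. induction n as [|n IH]; simpl; [lra|].
apply Rmult_lt_0_compat; [easy|].
assert (0 < p ^ n <= 1).
{ split; [apply pow_lt; lra|]. rewrite <- (pow1 n). apply pow_incr; lra. }
nra.
Qed.

Lemma qpoch_antitone a b p n : 0 < p < 1 -> a <= b -> b < 1 -> qpoch b p n <= qpoch a p n.
Proof.
intros Hp Hab Hb. induction n as [|n IH]; simpl; [lra|].
assert (0 < p ^ n <= 1).
{ split; [apply pow_lt; lra|]. rewrite <- (pow1 n). apply pow_incr; lra. }
assert (0 < qpoch b p n) by now apply qpoch_pos.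
apply Rmult_le_compat; nra.
Qed.

Lemma qpoch_head a p n : qpoch a p (S n) = (1 - a) * qpoch (a * p) p n.
Proof.
induction n as [|n IH]; [simpl; ring|].
change (qpoch a p (S (S n))) with (qpoch a p (S n) * (1 - a * p ^ S n)).
rewrite IH. simpl. ring.
Qed.

Section QBessel.

Variable p : R.
Hypothesis Hp : 0 < p < 1.

(** * The power series of the q-Bessel functions *)

Lemma pow_p_pos n : 0 < p ^ n.
Proof. apply pow_lt; lra. Qed.

Lemma pow_p_le_1 n : p ^ n <= 1.
Proof. rewrite <- (pow1 n). apply pow_incr; lra. Qed.

(** For [a = p^(nu+1)] the powers of [p] combine to [p^(n(n+nu))], and raising [nu] by 1 multiplies
    [a] by [p]. The truncated [n - 1] at [n = 0] is harmless, as it is multiplied by [n]. *)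
Definition qb_coef (a : R) (n : nat) : R :=
  (-1) ^ n * p ^ (n * (n - 1)) * a ^ n / (qpoch p p n * qpoch a p n).

Definition qb (a x : R) : R := PSeries (qb_coef a) x.

Lemma qb_coef_0 a : qb_coef a 0 = 1.
Proof. unfold qb_coef. simpl. field. Qed.

Lemma qb_coef_step a n : 0 < a < 1 ->
  qb_coef a (S n) = - qb_coef a n * (a * (p ^ n * p ^ n)) / ((1 - p * p ^ n) * (1 - a * p ^ n)).
Proof.
intros Ha. unfold qb_coef.
assert (H1 := qpoch_pos p p (S n) Hp ltac:(lra)).
assert (H2 := qpoch_pos a p (S n) Hp ltac:(lra)).
assert (H3 := qpoch_pos p p n Hp ltac:(lra)).
assert (H4 := qpoch_pos a p n Hp ltac:(lra)).
simpl qpoch in *.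
assert (N1 : 1 - p * p ^ n <> 0) by (intros E; rewrite E in H1; lra).
assert (N2 : 1 - a * p ^ n <> 0) by (intros E; rewrite E in H2; lra).
replace (S n * (S n - 1))%nat with (n * (n - 1) + (n + n))%nat by (destruct n; simpl; lia).
rewrite !pow_add. simpl. field. repeat split; lra.
Qed.

Lemma qb_coef_neq_0 a n : 0 < a < 1 -> qb_coef a n <> 0.
Proof.
intros Ha. unfold qb_coef.
assert (H3 := qpoch_pos p p n Hp ltac:(lra)).
assert (H4 := qpoch_pos a p n Hp ltac:(lra)).
assert (H5 := pow_p_pos (n * (n - 1))).
apply Rmult_integral_contrapositive_currified.
- repeat apply Rmult_integral_contrapositive_currified; try (apply pow_nonzero; lra).
- apply Rinv_neq_0_compat. nra.
Qed.

(** The ratio of consecutive coefficients is at most a constant times [p ^ n]. *)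
Lemma qb_CV_radius a : 0 < a < 1 -> CV_radius (qb_coef a) = p_infty.
Proof.
intros Ha. apply CV_radius_infinite_DAlembert; [intros; now apply qb_coef_neq_0|].
apply is_lim_seq_le_le with (fun _ => 0) (fun n => (/ ((1 - p) * (1 - a))) * p ^ n).
- intros n. split; [apply Rabs_pos|].
  assert (P := pow_p_pos n). assert (P1 := pow_p_le_1 n).
  rewrite qb_coef_step by easy.
  assert (D1 : 1 - p <= 1 - p * p ^ n) by nra.
  assert (D2 : 1 - a <= 1 - a * p ^ n) by nra.
  assert (0 < (1 - p) * (1 - a)) by nra.
  assert ((1 - p) * (1 - a) <= (1 - p * p ^ n) * (1 - a * p ^ n)) by (apply Rmult_le_compat; lra).
  replace (- qb_coef a n * (a * (p ^ n * p ^ n)) / ((1 - p * p ^ n) * (1 - a * p ^ n)) / qb_coef a n)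
    with (- (a * (p ^ n * p ^ n) / ((1 - p * p ^ n) * (1 - a * p ^ n)))).
  2: { field. repeat split; first [lra|now apply qb_coef_neq_0]. }
  rewrite Rabs_Ropp, Rabs_pos_eq.
  2: { apply Rmult_le_pos; [repeat apply Rmult_le_pos; lra|apply Rlt_le, Rinv_0_lt_compat; lra]. }
  unfold Rdiv. rewrite Rmult_comm. apply Rmult_le_compat.
  + apply Rlt_le, Rinv_0_lt_compat; lra.
  + repeat apply Rmult_le_pos; lra.
  + now apply Rinv_le_contravar.
  + assert (a * (p ^ n * p ^ n) <= 1 * (1 * p ^ n)); [|lra].
    apply Rmult_le_compat; nra.
- apply is_lim_seq_const.
- replace (Finite 0) with (Rbar_mult (/ ((1 - p) * (1 - a))) 0) by (simpl; f_equal; ring).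
  apply is_lim_seq_scal_l, is_lim_seq_geom. rewrite Rabs_pos_eq; lra.
Qed.

Lemma qb_abs_summable a x : 0 < a < 1 -> ex_series (fun n => Rabs (qb_coef a n * x ^ n)).
Proof. intros Ha. apply CV_disk_inside. now rewrite qb_CV_radius. Qed.

Lemma qb_ex_pseries a x : 0 < a < 1 -> ex_pseries (qb_coef a) x.
Proof. intros Ha. apply CV_radius_inside. now rewrite qb_CV_radius. Qed.

Lemma qb_continuous a x : 0 < a < 1 -> continuous (qb a) x.
Proof.
intros Ha. apply continuity_pt_filterlim, PSeries_continuity. now rewrite qb_CV_radius.
Qed.

Lemma qb_0 a : qb a 0 = 1.
Proof. unfold qb. rewrite PSeries_0. apply qb_coef_0. Qed.

(** The three-term recurrence of the q-Bessel functions, verified on coefficients; the factor [x]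
    shifts the last series by one index. *)
Lemma qb_contiguous a x : 0 < a < 1 ->
  qb a x = qb (a * p) x - x * (a / ((1 - a) * (1 - a * p))) * qb (a * p * p) x.
Proof.
intros Ha.
assert (Ha1 : 0 < a * p < 1) by nra.
assert (Ha2 : 0 < a * p * p < 1) by nra.
unfold qb at 3. rewrite Rmult_assoc, <- PSeries_scal, Rmult_comm, <- Rmult_comm.
rewrite <- PSeries_incr_1. unfold qb. rewrite <- PSeries_minus.
- apply PSeries_ext. intros [|n].
  + rewrite qb_coef_0. unfold PS_minus, PS_plus, PS_opp. rewrite qb_coef_0. simpl.
    change (1 = 1 + - 0). ring.
  + change (qb_coef a (S n) = qb_coef (a * p) (S n) + - (a / ((1 - a) * (1 - a * p)) * qb_coef (a * p * p) n)).
    unfold qb_coef.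
    assert (H1 := qpoch_pos p p (S n) Hp ltac:(lra)).
    assert (H3 := qpoch_pos p p n Hp ltac:(lra)).
    assert (H4 := qpoch_pos (a * p * p) p n Hp ltac:(lra)).
    assert (H5 := qpoch_pos (a * p) p (S n) Hp ltac:(lra)).
    assert (H6 : 1 - a * p * p ^ n <> 0).
    { intros E. rewrite qpoch_head in H5. simpl in H5.
      assert (H7 := qpoch_pos (a * p) p (S n) Hp ltac:(lra)). simpl in H7. rewrite E in H7. lra. }
    assert (H8 := qpoch_head (a * p) p n). simpl in H8.
    assert (H9 : qpoch (a * p * p) p n = qpoch (a * p) p n * (1 - a * p * p ^ n) / (1 - a * p)).
    { rewrite H8. field. lra. }
    rewrite (qpoch_head a). rewrite H9 in *.
    assert (H10 := qpoch_pos (a * p) p n Hp ltac:(lra)).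
    simpl qpoch in *.
    assert (N1 : 1 - p * p ^ n <> 0) by (intros E; rewrite E in H1; lra).
    replace (S n * (S n - 1))%nat with (n * (n - 1) + (n + n))%nat by (destruct n; simpl; lia).
    rewrite !pow_add, !Rpow_mult_distr. simpl. field. repeat split; lra.
- now apply qb_ex_pseries.
- apply ex_pseries_incr_1, ex_pseries_scal; [apply Rmult_comm|]. now apply qb_ex_pseries.
Qed.

(** Increasing [a] enlarges the numerator and shrinks the positive denominator, so [b] dominates all
    shifted parameters [b * p ^ i]. *)
Lemma qb_coef_le a b n : 0 < a -> a <= b -> b < 1 ->
  Rabs (qb_coef a n) <= Rabs (qb_coef b n).
Proof.
intros Ha Hab Hb. unfold qb_coef, Rdiv. rewrite !Rabs_mult.
assert (H3 := qpoch_pos p p n Hp ltac:(lra)).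
assert (H4 := qpoch_pos b p n Hp ltac:(lra)).
assert (H5 := qpoch_antitone a b p n Hp Hab Hb).
apply Rmult_le_compat; try apply Rabs_pos.
- repeat apply Rmult_le_pos; apply Rabs_pos.
- apply Rmult_le_compat_l; [apply Rmult_le_pos; apply Rabs_pos|].
  rewrite <- !RPow_abs. apply pow_incr. rewrite !Rabs_pos_eq; lra.
- rewrite !Rabs_inv, !Rabs_mult, !(Rabs_pos_eq (qpoch _ _ _)) by lra.
  apply Rinv_le_contravar; [nra|]. apply Rmult_le_compat_l; lra.
Qed.

Lemma qb_bound a b x X : 0 < a -> a <= b -> b < 1 -> Rabs x <= X ->
  Rabs (qb a x) <= Series (fun n => Rabs (qb_coef b n * X ^ n)).
Proof.
intros Ha Hab Hb Hx.
assert (Sa := qb_abs_summable a x ltac:(lra)).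
unfold qb, PSeries. apply Rle_trans with (1 := Series_Rabs _ Sa).
apply Series_le; [|apply qb_abs_summable; lra].
intros n. split; [apply Rabs_pos|].
rewrite !Rabs_mult. apply Rmult_le_compat; try apply Rabs_pos.
- now apply qb_coef_le.
- rewrite <- !RPow_abs. apply pow_incr. split; [apply Rabs_pos|].
  apply Rle_trans with (1 := Hx), Rle_abs.
Qed.

(** Every term beyond the constant 1 contains at least one factor [p ^ i]; what is left is dominated
    by the term with parameter [b]. *)
Lemma qb_near_1 b x i : 0 < b < 1 ->
  Rabs (qb (b * p ^ i) x - 1) <= p ^ i * Series (fun n => Rabs (qb_coef b n * x ^ n)).
Proof.
intros Hb. assert (P := pow_p_pos i). assert (P1 := pow_p_le_1 i).
assert (Ha : 0 < b * p ^ i < 1) by nra.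
assert (E : qb (b * p ^ i) x - 1 = Series (fun n => qb_coef (b * p ^ i) (S n) * x ^ S n)).
{ unfold qb, PSeries. rewrite Series_incr_1 by (apply ex_series_Rabs, qb_abs_summable; easy).
  rewrite qb_coef_0. simpl. ring. }
rewrite E.
assert (Sb := qb_abs_summable b x Hb).
assert (Sb1 := proj1 (ex_series_incr_1 _) Sb). simpl in Sb1.
assert (Sa1 := proj1 (ex_series_incr_1 _) (qb_abs_summable _ x Ha)).
apply Rle_trans with (1 := Series_Rabs _ Sa1).
apply Rle_trans with (p ^ i * Series (fun n => Rabs (qb_coef b (S n) * x ^ S n))).
- rewrite <- Series_scal_l. apply Series_le; [|now apply ex_series_Rscal].
  intros n. split; [apply Rabs_pos|]. rewrite !Rabs_mult, <- Rmult_assoc.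
  apply Rmult_le_compat_r; [apply Rabs_pos|].
  assert (HQ := qpoch_antitone (b * p ^ i) b p (S n) Hp ltac:(nra) ltac:(lra)).
  assert (HQb := qpoch_pos b p (S n) Hp ltac:(lra)).
  assert (HQp := qpoch_pos p p (S n) Hp ltac:(lra)).
  unfold qb_coef, Rdiv. rewrite !Rabs_mult, <- !Rmult_assoc.
  apply Rmult_le_compat; try apply Rabs_pos.
  + repeat apply Rmult_le_pos; apply Rabs_pos.
  + set (y := Rabs ((-1) ^ S n)). set (y' := Rabs (p ^ (S n * (S n - 1)))).
    replace (p ^ i * y * y' * Rabs (b ^ S n)) with (y * y' * (Rabs (b ^ S n) * p ^ i)) by ring.
    apply Rmult_le_compat_l; [apply Rmult_le_pos; apply Rabs_pos|].
    rewrite !Rabs_pos_eq by (apply pow_le; lra).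
    rewrite Rpow_mult_distr. apply Rmult_le_compat_l; [apply pow_le; lra|].
    assert ((p ^ i) ^ n <= 1) by (rewrite <- (pow1 n); apply pow_incr; lra).
    simpl. nra.
  + rewrite !Rabs_inv, !Rabs_mult, !(Rabs_pos_eq (qpoch _ _ _)) by lra.
    apply Rinv_le_contravar; [nra|]. apply Rmult_le_compat_l; lra.
- apply Rmult_le_compat_l; [lra|].
  rewrite (Series_incr_1 (fun n => Rabs (qb_coef b n * x ^ n))) by easy.
  generalize (Rabs_pos (qb_coef b 0 * x ^ 0)). lra.
Qed.

(** * The Jacobi operator of the recurrence *)

Variable b : R.
Hypothesis Hb : 0 < b < 1.

Definition beta (i : nat) : R :=
  b * p ^ i / ((1 - b * p ^ i) * (1 - b * p ^ i * p)).
Definition jac_coef (i : nat) : R := sqrt (beta i).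

Fixpoint jac_prod (i : nat) : R :=
  match i with O => 1 | S k => jac_prod k * jac_coef k end.

Definition qb_vec (z : R) (i : nat) : R :=
  z ^ i * jac_prod i * qb (b * p ^ S i) (z ^ 2).
Definition qb_even (z : R) : R := qb b (z ^ 2).

Lemma bp_range i : 0 < b * p ^ i < 1.
Proof. generalize (pow_p_pos i) (pow_p_le_1 i). nra. Qed.

Lemma beta_pos i : 0 < beta i.
Proof.
assert (H := bp_range i). assert (b * p ^ i * p < 1) by nra.
apply Rdiv_lt_0_compat; [easy|]. apply Rmult_lt_0_compat; lra.
Qed.

Lemma beta_decay i : beta (S i) <= p * beta i.
Proof.
assert (H := bp_range i). unfold beta.
replace (b * p ^ S i) with (b * p ^ i * p) by (simpl; ring).
set (c := b * p ^ i) in *.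
assert (0 < c * p < 1) by nra. assert (0 < c * p * p < 1) by nra.
unfold Rdiv. rewrite <- Rmult_assoc, (Rmult_comm p c).
apply Rmult_le_compat_l; [lra|]. apply Rinv_le_contravar; [nra|].
rewrite Rmult_comm. apply Rmult_le_compat_l; [lra|]. nra.
Qed.

Lemma beta_lim : is_lim_seq beta 0.
Proof.
apply is_lim_seq_le_le with (fun _ => 0) (fun i => beta 0 * p ^ i).
- intros i. split; [apply Rlt_le, beta_pos|].
  induction i as [|i IH]; [simpl; lra|].
  apply Rle_trans with (1 := beta_decay i). simpl. nra.
- apply is_lim_seq_const.
- replace (Finite 0) with (Rbar_mult (beta 0) 0) by (simpl; f_equal; ring).
  apply is_lim_seq_scal_l, is_lim_seq_geom. rewrite Rabs_pos_eq; lra.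
Qed.

Lemma jac_coef_pos i : 0 < jac_coef i.
Proof. apply sqrt_lt_R0, beta_pos. Qed.

Lemma jac_coef_sq i : jac_coef i ^ 2 = beta i.
Proof. apply pow2_sqrt, Rlt_le, beta_pos. Qed.

Lemma jac_coef_lim e : 0 < e -> exists n, forall i, (n <= i)%nat -> jac_coef i <= e.
Proof.
intros He. assert (H := beta_lim). apply is_lim_seq_Reals in H.
destruct (H (e ^ 2)) as [n Hn]; [nra|]. exists n. intros i Hi.
specialize (Hn i Hi). unfold Rdist in Hn. rewrite Rminus_0_r in Hn.
apply Rabs_def2 in Hn. rewrite <- jac_coef_sq in Hn.
generalize (jac_coef_pos i). nra.
Qed.

Lemma jac_prod_pos i : 0 < jac_prod i.
Proof.
induction i as [|i IH]; simpl; [lra|]. apply Rmult_lt_0_compat; [easy|apply jac_coef_pos].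
Qed.

Lemma qb_vec_contiguous i x :
  qb (b * p ^ i) x = qb (b * p ^ S i) x - x * beta i * qb (b * p ^ S (S i)) x.
Proof.
rewrite qb_contiguous by apply bp_range. unfold beta.
replace (b * p ^ S (S i)) with (b * p ^ i * p * p) by (simpl; ring).
replace (b * p ^ S i) with (b * p ^ i * p) by (simpl; ring). easy.
Qed.

(** Row [i] is [qb_vec_contiguous i] times [z ^ i * jac_prod i]. The lower neighbour missing in row
    0 leaves [qb_even z] on the right. *)
Lemma qb_vec_eq z i :
  qb_vec z i - z * jac jac_coef (qb_vec z) i = qb_even z * basis0 i.
Proof.
assert (Sq := jac_coef_sq).
unfold jac. destruct i as [|i]; simpl shiftr; simpl basis0.
- unfold qb_even. replace (qb b (z ^ 2)) with (qb (b * p ^ 0) (z ^ 2)) by (f_equal; simpl; ring).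
  rewrite (qb_vec_contiguous 0), <- Sq. unfold qb_vec. simpl. ring.
- unfold qb_vec. rewrite (qb_vec_contiguous (S i)), <- Sq. simpl. ring.
Qed.

(** The squared majorants have ratio [X^2 beta i], which tends to 0. One majorant for the whole disk
    yields both square-summability and continuity of the kernel. *)
Lemma qb_vec_bound X : 0 < X -> exists m : nat -> R, ex_series (fun i => m i ^ 2) /\
  (forall i, 0 <= m i) /\ forall z i, Rabs z <= X -> Rabs (qb_vec z i) <= m i.
Proof.
intros HX.
set (B := Series (fun n => Rabs (qb_coef b n * (X ^ 2) ^ n))).
assert (HB : 0 <= B).
{ apply Series_nonneg; [intros; apply Rabs_pos|]. now apply qb_abs_summable. }
assert (PX : forall i, 0 < X ^ i) by (intros; now apply pow_lt).
exists (fun i => X ^ i * jac_prod i * B). split; [|split].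
- apply ex_series_ext with (fun i => B ^ 2 * Rabs ((X ^ i * jac_prod i) ^ 2)).
  { intros i. rewrite Rabs_pos_eq by apply pow2_ge_0. simpl; ring. }
  apply ex_series_Rscal. apply ex_series_DAlembert with 0; [lra| |].
  + intros i. apply pow_nonzero. generalize (PX i) (jac_prod_pos i). nra.
  + apply is_lim_seq_ext with (fun i => X ^ 2 * beta i).
    * intros i. rewrite <- jac_coef_sq.
      replace ((X ^ S i * jac_prod (S i)) ^ 2 / (X ^ i * jac_prod i) ^ 2) with (X ^ 2 * jac_coef i ^ 2).
      -- rewrite Rabs_pos_eq; [easy|]. apply Rmult_le_pos; apply pow2_ge_0.
      -- simpl. field. split; apply Rgt_not_eq; [apply jac_prod_pos|apply PX].
    * replace (Finite 0) with (Rbar_mult (X ^ 2) 0) by (simpl; f_equal; ring).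
      apply is_lim_seq_scal_l, beta_lim.
- intros i. repeat apply Rmult_le_pos; [apply Rlt_le, PX|apply Rlt_le, jac_prod_pos|easy].
- intros z i Hz. unfold qb_vec. rewrite !Rabs_mult.
  apply Rmult_le_compat; try apply Rabs_pos.
  + apply Rmult_le_pos; apply Rabs_pos.
  + rewrite (Rabs_pos_eq (jac_prod i)) by apply Rlt_le, jac_prod_pos.
    apply Rmult_le_compat_r; [apply Rlt_le, jac_prod_pos|].
    rewrite <- RPow_abs. apply pow_incr. split; [apply Rabs_pos|easy].
  + assert (H := bp_range (S i)). apply qb_bound; try lra.
    * generalize (pow_p_le_1 (S i)). nra.
    * rewrite <- RPow_abs. apply pow_incr. split; [apply Rabs_pos|easy].
Qed.

Lemma qb_vec_l2 z : l2 (qb_vec z).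
Proof.
destruct (qb_vec_bound (Rabs z + 1)) as [m [Hm [Pm H]]]; [generalize (Rabs_pos z); lra|].
apply ex_series_dom with (2 := Hm). intros i.
rewrite <- RPow_abs. apply pow_incr. split; [apply Rabs_pos|]. apply H; lra.
Qed.

Lemma qb_even_opp z : qb_even (- z) = qb_even z.
Proof. unfold qb_even. f_equal. ring. Qed.

Lemma qb_vec_0_opp z : qb_vec (- z) O = qb_vec z O.
Proof. unfold qb_vec. replace ((- z) ^ 2) with (z ^ 2) by ring. easy. Qed.

Lemma qb_vec_norm_opp z : dot (qb_vec (- z)) (qb_vec (- z)) = dot (qb_vec z) (qb_vec z).
Proof.
apply Series_ext. intros i. unfold qb_vec. replace ((- z) ^ 2) with (z ^ 2) by ring.
assert (E : (- z) ^ i * (- z) ^ i = z ^ i * z ^ i).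
{ rewrite <- !Rpow_mult_distr. f_equal. ring. }
set (c := jac_prod i). set (g := qb (b * p ^ S i) (z ^ 2)).
replace ((- z) ^ i * c * g * ((- z) ^ i * c * g)) with ((- z) ^ i * (- z) ^ i * (c * g) ^ 2) by ring.
rewrite E. ring.
Qed.

(* Otherwise all [qb (b * p ^ i)] vanish at [z ^ 2], but they tend to 1. *)
Lemma qb_vec_nondeg z : qb_even z = 0 -> qb_vec z O <> 0.
Proof.
intros H0 H1. unfold qb_even in H0. unfold qb_vec in H1. simpl (z ^ 0) in H1. simpl jac_prod in H1.
rewrite !Rmult_1_l in H1.
destruct (Req_dec z 0) as [E|E].
{ rewrite E in H0. replace (0 ^ 2) with 0 in H0 by ring. rewrite qb_0 in H0. lra. }
assert (P : forall i, qb (b * p ^ i) (z ^ 2) = 0 /\ qb (b * p ^ S i) (z ^ 2) = 0).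
{ induction i as [|i [IH1 IH2]].
  - split; [|easy]. simpl. now rewrite Rmult_1_r.
  - split; [easy|]. rewrite (qb_vec_contiguous i), IH2 in IH1.
    assert (Q : z ^ 2 * beta i <> 0).
    { apply Rmult_integral_contrapositive_currified; [now apply pow_nonzero|].
      apply Rgt_not_eq, beta_pos. }
    apply Rmult_eq_reg_l with (z ^ 2 * beta i); [|easy]. lra. }
set (B := Series (fun n => Rabs (qb_coef b n * (z ^ 2) ^ n))).
assert (L : is_lim_seq (fun i => B * p ^ i) 0).
{ replace (Finite 0) with (Rbar_mult B 0) by (simpl; f_equal; ring).
  apply is_lim_seq_scal_l, is_lim_seq_geom. rewrite Rabs_pos_eq; lra. }
apply is_lim_seq_Reals in L. destruct (L 1 Rlt_0_1) as [n Hn].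
specialize (Hn n ltac:(lia)). unfold Rdist in Hn. rewrite Rminus_0_r in Hn.
apply Rabs_def2 in Hn.
assert (H := qb_near_1 b (z ^ 2) n Hb). fold B in H.
rewrite (proj1 (P n)), Rminus_0_l, Rabs_Ropp, Rabs_R1 in H. lra.
Qed.

Lemma qb_even_continuous z : continuous qb_even z.
Proof.
unfold qb_even. apply (continuous_comp (fun t => t ^ 2) (qb b)).
- apply (ex_derive_continuous (fun t => t ^ 2)). auto_derive. easy.
- now apply qb_continuous.
Qed.

Lemma qb_vec_continuous i z : continuous (fun t => qb_vec t i) z.
Proof.
unfold qb_vec. apply (continuous_mult (fun t => t ^ i * jac_prod i)).
- apply (ex_derive_continuous (fun t => t ^ i * jac_prod i)). auto_derive. easy.
- apply (continuous_comp (fun t => t ^ 2) (qb (b * p ^ S i))).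
  + apply (ex_derive_continuous (fun t => t ^ 2)). auto_derive. easy.
  + apply qb_continuous, bp_range.
Qed.

Lemma qb_kernel_continuous z : continuous (fun t => dot (qb_vec z) (qb_vec t)) z.
Proof.
destruct (qb_vec_bound (Rabs z + 1)) as [m [Hm [Pm H]]]; [generalize (Rabs_pos z); lra|].
apply (continuous_Series_dom (fun i t => qb_vec z i * qb_vec t i) (fun i => m i ^ 2)).
- exact Hm.
- exists (mkposreal 1 Rlt_0_1). intros t Ht i.
  change (Rabs (t - z) < 1) in Ht.
  rewrite Rabs_mult. simpl. rewrite Rmult_1_r.
  apply Rmult_le_compat; try apply Rabs_pos; apply H; [lra|].
  replace t with (z + (t - z)) by ring. apply Rle_trans with (1 := Rabs_triang _ _). lra.
- intros i. apply (continuous_mult (fun _ => qb_vec z i)); [apply continuous_const|].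
  apply qb_vec_continuous.
Qed.

Definition delta (k i : nat) : R := if Nat.eq_dec i k then 1 else 0.

Lemma l2_delta k : l2 (delta k).
Proof.
eexists. apply (Series_finite _ (S k)). intros i Hi. unfold delta.
destruct (Nat.eq_dec i k); [lia|]. simpl; ring.
Qed.

Lemma dot_delta_self k : dot (delta k) (delta k) = 1.
Proof.
assert (D : forall i, delta k i * delta k i = delta k i).
{ intros i. unfold delta. destruct (Nat.eq_dec i k); ring. }
unfold dot. rewrite (Series_ext _ _ D). apply is_series_unique.
replace 1 with (sum_n (delta k) (S k) : R).
- apply Series_finite. intros i Hi. unfold delta. destruct (Nat.eq_dec i k); [lia|easy].
- assert (E0 : forall i, i <> k -> delta k i = 0).
  { intros i Hi. unfold delta. now destruct (Nat.eq_dec i k). }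
  assert (E1 : delta k k = 1).
  { unfold delta. now destruct (Nat.eq_dec k k). }
  rewrite sum_n_Reals. simpl. rewrite (E0 (S k)) by lia.
  destruct k as [|k]; simpl; rewrite E1; [ring|].
  rewrite sum_eq_R0; [ring|]. intros i Hi. apply E0. lia.
Qed.

(* Modulo the range of [jac], the basis vector [2 n] is the multiple
   [- s (2 n + 1) / s (2 n)] of the basis vector [2 n + 2]. *)
Lemma jac_range_dense e : 0 < e -> exists v, l2 v /\
  let d := vplus basis0 (vscal (-1) (jac jac_coef v)) in dot d d <= e.
Proof.
intros He.
assert (St : forall n, exists v r, l2 v /\ r ^ 2 <= p ^ n /\
  forall i, basis0 i + -1 * jac jac_coef v i = r * delta (2 * n) i).
{ induction n as [|n [v [r [Hv [Hr E]]]]].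
  - exists (vscal 0 basis0), 1. split; [apply l2_scal, l2_basis0|]. split; [simpl; lra|].
    intros i. rewrite jac_scal. unfold vscal, delta, basis0. destruct i; simpl; ring.
  - set (k := (2 * n)%nat) in *.
    assert (P := jac_coef_pos k). assert (P1 := jac_coef_pos (S k)).
    (* [A] maps the basis vector [k + 1] to [s k] times vector [k] plus [s (k + 1)] times vector
       [k + 2]; this multiple of it cancels the error at [k]. The squared error is multiplied by
       [beta (S k) / beta k], at most [p]. *)
    exists (vplus v (vscal (r / jac_coef k) (delta (S k)))), (- r * jac_coef (S k) / jac_coef k).
    split; [apply l2_plus, l2_scal, l2_delta; easy|]. split.
    + replace ((- r * jac_coef (S k) / jac_coef k) ^ 2) with (r ^ 2 * (beta (S k) / beta k)).
      2: { rewrite <- !jac_coef_sq. field. lra. }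
      change (p ^ S n) with (p * p ^ n). rewrite (Rmult_comm p).
      apply Rmult_le_compat; [apply pow2_ge_0| |easy|].
      * apply Rlt_le, Rdiv_lt_0_compat; apply beta_pos.
      * apply Rmult_le_reg_r with (beta k); [apply beta_pos|].
        unfold Rdiv. rewrite Rmult_assoc, Rinv_l by apply Rgt_not_eq, beta_pos.
        rewrite Rmult_1_r. apply beta_decay.
    + intros i. rewrite jac_plus. unfold vplus. rewrite jac_scal. unfold vscal.
      replace (basis0 i + -1 * (jac jac_coef v i + r / jac_coef k * jac jac_coef (delta (S k)) i))
        with (r * delta k i - r / jac_coef k * jac jac_coef (delta (S k)) i)
        by (rewrite <- E; ring).
      replace (2 * S n)%nat with (S (S k)) by (unfold k; lia).
      unfold jac, delta. destruct i as [|i]; simpl shiftr.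
      * destruct (Nat.eq_dec 0 k), (Nat.eq_dec 1 (S k)), (Nat.eq_dec 0 (S (S k))); try lia.
        -- subst k. rewrite <- e0. field. rewrite e0; lra.
        -- ring.
      * destruct (Nat.eq_dec (S i) k), (Nat.eq_dec (S (S i)) (S k)),
          (Nat.eq_dec i (S k)), (Nat.eq_dec (S i) (S (S k))); try lia.
        -- rewrite e0. field. lra.
        -- rewrite e0. field. lra.
        -- ring. }
assert (L : is_lim_seq (fun n => p ^ n) 0) by (apply is_lim_seq_geom; rewrite Rabs_pos_eq; lra).
apply is_lim_seq_Reals in L. destruct (L e He) as [n Hn].
specialize (Hn n ltac:(lia)). unfold Rdist in Hn. rewrite Rminus_0_r in Hn.
apply Rabs_def2 in Hn.
destruct (St n) as [v [r [Hv [Hr E]]]]. exists v. split; [easy|]. intros d.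
assert (E' : forall i, d i = vscal r (delta (2 * n)) i) by exact E.
rewrite (dot_ext _ _ _ _ E' E'), dot_scal_l, dot_scal_r, dot_delta_self. nra.
Qed.

End QBessel.

(** * The q-Rayleigh functions *)

(** Christoffel-Darboux supplies such a factorization at a zero, so the Bessel function needs no
    termwise differentiation. *)
Lemma is_derive_factor (f g : R -> R) x :
  locally x (fun t => f t = (t - x) * g t) -> continuous g x -> is_derive f x (g x).
Proof.
intros Hf Hg. apply is_derive_Reals. intros e He.
assert (Hx := locally_singleton _ _ Hf). simpl in Hx.
assert (H := proj1 (filterlim_locally _ _) Hg (mkposreal e He)).
destruct (filter_and _ _ Hf H) as [d Hd].
exists d. intros h Hh0 Hh.
destruct (Hd (x + h)) as [E B].
{ change (Rabs (x + h - x) < d). now replace (x + h - x) with h by ring. }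
change (Rabs (g (x + h) - g x) < e) in B.
rewrite E, Hx. replace (((x + h - x) * g (x + h) - (x - x) * g x) / h) with (g (x + h)) by now field.
exact B.
Qed.

Lemma is_series_Rscal (c : R) (a : nat -> R) l :
  is_series a l -> is_series (fun n => c * a n) (c * l).
Proof. exact (is_series_scal_l c a l). Qed.

(** The constant term is the limit of the sum along points decreasing to 0; dividing by [y] then
    passes to the shifted series. *)
Lemma pseries_0_unique (e : nat -> R) d : 0 < d ->
  (forall y, 0 < y < d -> is_series (fun n => e n * y ^ n) 0) -> forall n, e n = 0.
Proof.
intros Hd He n. revert e He.
assert (H0 : forall e, (forall y, 0 < y < d -> is_series (fun n => e n * y ^ n) 0) -> e O = 0).
{ intros e He.
  assert (CV : Rbar_lt (Rabs 0) (CV_radius e)).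
  { apply Rbar_not_le_lt. intros L.
    apply (CV_disk_outside e (d / 2)).
    - apply Rbar_le_lt_trans with (1 := L). simpl. rewrite Rabs_R0, Rabs_pos_eq; lra.
    - apply ex_series_lim_0. exists 0. apply He. lra. }
  assert (C := PSeries_continuity e 0 CV).
  rewrite <- PSeries_0.
  assert (L : is_lim_seq (fun k => d / 2 * / INR (S k)) 0).
  { replace (Finite 0) with (Rbar_mult (d / 2) 0) by (simpl; f_equal; ring).
    apply is_lim_seq_scal_l. replace (Finite 0) with (Rbar_inv p_infty) by easy.
    apply is_lim_seq_inv; [|easy]. apply (is_lim_seq_incr_1 INR), is_lim_seq_INR. }
  assert (L' := is_lim_seq_continuous (PSeries e) _ 0 C L).
  apply is_lim_seq_unique in L'.
  rewrite (Lim_seq_ext _ (fun _ => 0)), Lim_seq_const in L'; [now injection L'|].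
  intros k. apply is_series_unique, He.
  assert (1 <= INR (S k)) by (rewrite S_INR; generalize (pos_INR k); lra).
  assert (0 < / INR (S k) <= 1).
  { split; [apply Rinv_0_lt_compat; lra|]. rewrite <- Rinv_1. apply Rinv_le_contravar; lra. }
  nra. }
induction n as [|n IH]; intros e He; [now apply H0|].
apply (IH (fun k => e (S k))). intros y Hy.
assert (H := He y Hy).
assert (H' : is_series (fun k => e (S k) * y ^ S k) 0).
{ apply (is_series_incr_1 (fun k => e k * y ^ k)).
  change (is_series (fun k => e k * y ^ k) (0 + e O * y ^ 0)).
  now rewrite (H0 e He), Rmult_0_l, Rplus_0_r. }
apply (is_series_Rscal (/ y)) in H'. rewrite Rmult_0_r in H'.
apply is_series_ext with (2 := H'). intros k. simpl. field. lra.
Qed.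

Lemma qpoch_inf_head a p : a < 1 -> qpoch_inf a p = (1 - a) * qpoch_inf (a * p) p.
Proof.
intros Ha. unfold qpoch_inf.
rewrite <- Lim_seq_incr_1, (Lim_seq_ext _ _ (qpoch_head a p)), Lim_seq_scal_l.
(* For an infinite limit both sides are 0 by the default value of [real], so convergence of the
   product need not be known. *)
destruct (Lim_seq (qpoch (a * p) p)); simpl; [easy| |];
  unfold Rbar_mult'; destruct (Rle_dec 0 (1 - a)); try destruct (Rle_lt_or_eq_dec 0 (1 - a) _);
  simpl; ring.
Qed.

Lemma Rpower_base_range p x : 0 < p < 1 -> 0 < x -> 0 < Rpower p x < 1.
Proof.
intros Hp Hx. split; [apply exp_pos|].
rewrite <- exp_0. apply exp_increasing.
assert (ln p < 0) by (rewrite <- ln_1; apply ln_increasing; lra). nra.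
Qed.

Lemma jackson2_qb nu z p : 0 < p < 1 -> 0 < z ->
  jackson2 nu z p = qpoch_inf (Rpower p (nu + 1)) p / qpoch_inf p p *
    (Rpower (z / 2) nu * qb p (Rpower p (nu + 1)) ((z / 2) ^ 2)).
Proof.
intros Hp Hz. unfold jackson2. f_equal. unfold qb, PSeries. rewrite <- Series_scal_l.
apply Series_ext. intros n. unfold qb_coef.
set (b := Rpower p (nu + 1)).
replace (Rpower p (INR n * (INR n + nu))) with (p ^ (n * (n - 1)) * b ^ n).
2: { unfold b. rewrite <- Rpower_pow, <- (Rpower_pow n) by (apply exp_pos || lra).
     rewrite Rpower_mult, <- Rpower_plus. f_equal. rewrite mult_INR.
     destruct n as [|n]; [simpl; ring|]. rewrite minus_INR by lia. rewrite !S_INR. simpl. ring. }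
replace (Rpower (z / 2) (2 * INR n + nu)) with (Rpower (z / 2) nu * ((z / 2) ^ 2) ^ n).
2: { rewrite <- pow_mult, <- Rpower_pow, <- Rpower_plus by lra. f_equal.
     rewrite mult_INR. simpl. ring. }
unfold Rdiv. ring.
Qed.

Theorem theorem4p1 (q nu : R) (hq : 0 < q < 1) (hnu : -1 < nu)
  (j : nat -> R) (hj : positive_zeros (fun z => jackson2 nu z (q ^ 2)) j)
  (sigma : nat -> R) (hsigma : q_rayleigh nu (q ^ 2) sigma)
  (n : nat) (hn : (1 <= n)%nat) :
  let a := fun k : nat =>
    jackson2 (nu + 1) (j (S k)) (q ^ 2) /
      Derive (fun z => jackson2 nu z (q ^ 2)) (j (S k)) *
    / (j (S k)) ^ (2 * n) in
  ex_series a /\ sigma n = - Series a.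
Proof.
intros a.
set (p := q ^ 2) in *.
assert (Hp : 0 < p < 1) by (unfold p; nra).
destruct hj as [jincr jzeros].
set (b := Rpower p (nu + 1)).
assert (Hb : 0 < b < 1) by (apply Rpower_base_range; lra).
set (kappa := qpoch_inf b p / qpoch_inf p p).
(* The spectral variable [t] is half the Bessel argument. *)
assert (HJ : forall t, 0 < t ->
  jackson2 nu (2 * t) p = kappa * (Rpower t nu * qb_even p b t)).
{ intros t Ht. rewrite jackson2_qb by lra. replace (2 * t / 2) with t by field. easy. }
assert (HJ1 : forall t, 0 < t -> jackson2 (nu + 1) (2 * t) p =
  kappa / (1 - b) * (t * Rpower t nu * qb_vec p b t O)).
{ intros t Ht. rewrite jackson2_qb by lra. replace (2 * t / 2) with t by field.
  replace (Rpower p (nu + 1 + 1)) with (b * p)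
    by (unfold b; rewrite (Rpower_plus (nu + 1)), Rpower_1 by lra; easy).
  rewrite Rpower_plus, Rpower_1 by lra.
  unfold kappa. rewrite (qpoch_inf_head b p) by lra.
  unfold qb_vec. rewrite pow_1. unfold Rdiv. set (w := / qpoch_inf p p).
  simpl. field. lra. }
assert (jpos : forall k, (1 <= k)%nat -> 0 < j k).
{ intros k Hk. apply (jzeros (j k)). now exists k. }
assert (jlt : forall k l, (1 <= k < l)%nat -> j k < j l).
{ intros k l [Hk Hl]. induction Hl as [|l Hl IH]; [now apply jincr|].
  apply Rlt_trans with (1 := IH), jincr. lia. }
(* Otherwise every positive number would be a zero, also those between [j 1] and [j 2]. *)
assert (Hkappa : kappa <> 0).
{ intros E. assert (P1 := jpos 1%nat (le_n 1)). assert (P2 := jincr 1%nat (le_n 1)).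
  set (z := (j 1%nat + j 2%nat) / 2).
  assert (Hz : j 1%nat < z < j 2%nat) by (unfold z; lra).
  destruct (proj1 (jzeros z)) as [k [Hk Ek]].
  - split; [lra|]. replace z with (2 * (z / 2)) by field. rewrite HJ by lra. rewrite E. ring.
  - destruct (Nat.eq_dec k 1) as [->|]; [lra|]. destruct (Nat.eq_dec k 2) as [->|]; [lra|].
    generalize (jlt 2%nat k ltac:(lia)). lra. }
assert (HR : forall t, 0 < Rpower t nu) by (intros; apply exp_pos).
(* Shifted by one because [j 0] is arbitrary. *)
set (Z := fun k => j (S k) / 2).
assert (Zpos : forall k, 0 < Z k) by (intros k; unfold Z; generalize (jpos (S k) ltac:(lia)); lra).
assert (Zincr : forall k, Z k < Z (S k)).
{ intros k. unfold Z. generalize (jincr (S k) ltac:(lia)). lra. }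
assert (Zzeros : forall t, 0 < t -> (qb_even p b t = 0 <-> exists k, Z k = t)).
{ intros t Ht. split.
  - intros E. destruct (proj1 (jzeros (2 * t))) as [k [Hk Ek]].
    + split; [lra|]. rewrite HJ, E by easy. ring.
    + destruct k as [|k]; [lia|]. exists k. unfold Z. rewrite Ek. field.
  - intros [k Ek]. destruct (proj2 (jzeros (2 * t))) as [_ E].
    + exists (S k). split; [lia|]. rewrite <- Ek. unfold Z. field.
    + rewrite HJ in E by easy. generalize (HR t); intros.
      apply Rmult_integral in E. destruct E as [E|E]; [easy|].
      apply Rmult_integral in E. destruct E as [E|E]; [lra|easy]. }
set (s := jac_coef p b).
set (u := qb_vec p b) in *.
assert (s_pos : forall i, 0 < s i) by now apply jac_coef_pos.
assert (s_lim := jac_coef_lim p Hp b Hb). fold s in s_lim.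
assert (u_l2 := qb_vec_l2 p Hp b Hb). fold u in u_l2.
assert (u_eq := qb_vec_eq p Hp b Hb). fold s u in u_eq.
assert (u_nondeg := qb_vec_nondeg p Hp b Hb). fold u in u_nondeg.
assert (u_even := qb_vec_0_opp p b). fold u in u_even.
assert (FZ : forall k, qb_even p b (Z k) = 0) by (intros k; apply Zzeros; [easy|now exists k]).
assert (HM := moment_series s s_pos s_lim u (qb_even p b) u_l2 u_eq (qb_even_opp p b) u_even
  (qb_vec_norm_opp p b) u_nondeg Z Zpos Zincr Zzeros (qb_even_continuous p Hp b Hb)
  (qb_kernel_continuous p Hp b Hb) (jac_range_dense p Hp b Hb)).
destruct n as [|m]; [lia|]. clear hn.
set (c := / ((1 - b) * 4 ^ S m)).
assert (P4 : 0 < 4 ^ S m) by (apply pow_lt; lra).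
(* Christoffel-Darboux turns the derivative at the zero into the squared norm of [u (Z k)], so each
   term is a Parseval term of [moment s m] up to the constant [- c]. *)
assert (Ha : forall k, a k = - c * (weight u Z k * (/ Z k ^ 2) ^ m)).
{ intros k. unfold a.
  assert (Pk := Zpos k). assert (Gk := u_nondeg _ (FZ k)). assert (Rk := HR (Z k)).
  assert (Nk := eigen_norm_pos u (qb_even p b) u_l2 u_nondeg _ (FZ k)).
  replace (j (S k)) with (2 * Z k) by (unfold Z; field).
  (* The cofactor of [t - 2 * Z k] in the Bessel function, read off from Christoffel-Darboux with
     [F (Z k) = 0]. *)
  set (g := fun t => - kappa / (2 * Z k * u (Z k) O) * (Rpower (t / 2) nu * dot (u (Z k)) (u (t / 2)))).
  assert (HD : is_derive (fun z => jackson2 nu z p) (2 * Z k) (g (2 * Z k))).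
  { apply is_derive_factor.
    - exists (mkposreal (2 * Z k) ltac:(lra)). intros t Ht.
      change (Rabs (t - 2 * Z k) < 2 * Z k) in Ht. apply Rabs_def2 in Ht.
      replace (jackson2 nu t p) with (jackson2 nu (2 * (t / 2)) p) by (f_equal; field).
      rewrite HJ by lra.
      assert (CD := Christoffel_Darboux s s_pos s_lim u (qb_even p b) u_l2 u_eq (Z k) (t / 2)).
      rewrite FZ in CD.
      assert (E : qb_even p b (t / 2) = (Z k - t / 2) * dot (u (Z k)) (u (t / 2)) / (Z k * u (Z k) O)).
      { rewrite <- CD. field. lra. }
      rewrite E. unfold g. field. lra.
    - unfold g.
      apply (continuous_mult (fun _ => - kappa / (2 * Z k * u (Z k) O))); [apply continuous_const|].
      apply (continuous_mult (fun t => Rpower (t / 2) nu)).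
      + apply (ex_derive_continuous (fun t => Rpower (t / 2) nu)). unfold Rpower. auto_derive. lra.
      + apply (continuous_comp (fun t => t / 2) (fun t => dot (u (Z k)) (u t))).
        * apply (ex_derive_continuous (fun t => t / 2)). auto_derive. easy.
        * replace (2 * Z k / 2) with (Z k) by field. now apply qb_kernel_continuous. }
  assert (HD' : Derive (fun z => jackson2 nu z p) (2 * Z k) = g (2 * Z k))
    by exact (is_derive_unique _ _ _ HD).
  rewrite HD', HJ1 by easy.
  unfold g. replace (2 * Z k / 2) with (Z k) by field.
  unfold weight, c. rewrite pow_mult, pow_inv.
  replace ((2 * Z k) ^ 2) with (4 * Z k ^ 2) by ring. rewrite Rpow_mult_distr.
  change ((Z k ^ 2) ^ S m) with (Z k ^ 2 * (Z k ^ 2) ^ m).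
  assert (0 < (Z k ^ 2) ^ m) by (apply pow_lt; nra).
  field. repeat split; lra. }
assert (Hs : is_series a (- c * moment s m)).
{ apply is_series_ext with (fun k => - c * (weight u Z k * (/ Z k ^ 2) ^ m)).
  - intros k. now rewrite Ha.
  - apply is_series_Rscal, HM. }
split; [now exists (- c * moment s m)|].
rewrite (is_series_unique _ _ Hs).
destruct hsigma as [r [Hr hsigma]].
destruct (moment_generating s s_pos s_lim u (qb_even p b) u_l2 u_eq u_nondeg) as [r' [Hr' HG]].
(* The moment expansion is used at [z / 2], hence [2 * r']. *)
set (d := Rmin r (2 * r')).
assert (Hd : 0 < d) by (apply Rmin_glb_lt; lra).
(* Comparing the two expansions of the Bessel quotient in powers of [y = z^2] identifies
   [sigma (S k)] with a multiple of [moment s k]. *)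
assert (He := pseries_0_unique (fun k => sigma (S k) - / ((1 - b) * 4 ^ S k) * moment s k) (d ^ 2)).
enough (E : sigma (S m) - c * moment s m = 0) by lra.
apply He; [nra|]. clear He. intros y Hy.
set (z := sqrt y).
assert (Hz2 : z ^ 2 = y) by (apply pow2_sqrt; lra).
assert (Hz : 0 < z < d).
{ assert (0 < z) by (apply sqrt_lt_R0; lra). split; [easy|]. nra. }
assert (Hzr : z < r) by (apply Rlt_le_trans with (1 := proj2 Hz), Rmin_l).
assert (Hzr' : z < 2 * r') by (apply Rlt_le_trans with (1 := proj2 Hz), Rmin_r).
destruct (hsigma z ltac:(lra)) as [Es Eq].
destruct (HG (z / 2) ltac:(lra)) as [HF HS].
set (t := z / 2) in *.
assert (Ht : 0 < t) by (unfold t; lra).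
replace z with (2 * t) in Eq at 1 2 by (unfold t; field).
rewrite HJ, HJ1 in Eq by easy.
apply Series_correct in Es.
apply (is_series_Rscal (/ z)) in Es. apply (is_series_Rscal (/ (4 * (1 - b)))) in HS.
assert (Ev : / z * Series (fun m => sigma (S m) * z ^ (2 * S m - 1)) + - (/ (4 * (1 - b)) * (u t O / qb_even p b t)) = 0).
{ replace (Series (fun m => sigma (S m) * z ^ (2 * S m - 1)))
    with (kappa / (1 - b) * (t * Rpower t nu * u t O) / (kappa * (Rpower t nu * qb_even p b t)) / 2)
    by (rewrite Eq; field).
  replace z with (2 * t) by (unfold t; field).
  generalize (HR t); intros. field. repeat split; lra || easy. }
rewrite <- Ev.
apply is_series_ext with (2 := is_series_minus _ _ _ _ Es HS).
intros k. change (/ z * (sigma (S k) * z ^ (2 * S k - 1)) + - (/ (4 * (1 - b)) * (moment s k * (t ^ 2) ^ k))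
  = (sigma (S k) - / ((1 - b) * 4 ^ S k) * moment s k) * y ^ k).
replace (2 * S k - 1)%nat with (S (2 * k)) by lia.
rewrite <- tech_pow_Rmult, pow_mult, Hz2.
replace (t ^ 2) with (y * / 4) by (rewrite <- Hz2; unfold t; field).
rewrite Rpow_mult_distr, pow_inv. simpl (4 ^ S k).
assert (0 < 4 ^ k) by (apply pow_lt; lra).
field. repeat split; lra.
Qed.
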